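(* Let $\mathbb D(\cdot\|\cdot)$ be a lower-semicontinuous quantum divergence with the direct-sum property. Let $\mathcal N\in\mathrm{CPTP}(AE:B)$ and $\mathcal M\in\mathrm{CP}(AE:B)$. Then the following four quantities are equal: $$\mathbb D^{\mathrm{mx}}(\mathcal N_{AE\to B}\|\mathcal M_{AE\to B}):=\sup_{\rho_{AR}\in\mathscr D(\mathcal H_A\otimes\mathcal H_R)}\ \inf_{\sigma_E,\omega_E\in\mathscr D(\mathcal H_E)}\mathbb D\big(\mathcal N_{AE\to B}(\rho_{AR}\otimes\sigma_E)\big\|\mathcal M_{AE\to B}(\rho_{AR}\otimes\omega_E)\big)$$ $$=\sup_{\rho_A\in\mathscr D(\mathcal H_A)}\ \inf_{\sigma_E,\omega_E\in\mathscr D(\mathcal H_E)}\mathbb D\big(\mathcal N_{AE\to B}(|\rho\rangle\langle\rho|_{AR}\otimes\sigma_E)\big\|\mathcal M_{AE\to B}(|\rho\rangle\langle\rho|_{AR}\otimes\omega_E)\big)$$ $$=\inf_{\sigma_E,\omega_E\in\mathscr D(\mathcal H_E)}\ \sup_{\rho_A\in\mathscr D(\mathcal H_A)}\mathbb D\big(\mathcal N_{AE\to B}(|\rho\rangle\langle\rho|_{AR}\otimes\sigma_E)\big\|\mathcal M_{AE\to B}(|\rho\rangle\langle\rho|_{AR}\otimes\omega_E)\big)$$ $$=\inf_{\sigma_E,\omega_E\in\mathscr D(\mathcal H_E)}\ \sup_{\rho_{AR}\in\mathscr D(\mathcal H_A\otimes\mathcal H_R)}\mathbb D\big(\mathcal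 N_{AE\to B}(\rho_{AR}\otimes\sigma_E)\big\|\mathcal M_{AE\to B}(\rho_{AR}\otimes\omega_E)\big).$$ Here in the first and fourth expressions $R$ is a reference system of arbitrary dimension (also optimized over), and in the second and third expressions $|\rho\rangle_{AR}$ is a purification of $\rho_A$ with $\mathcal H_R=\mathcal H_A$.
   Context: All quantum systems $A,B,E,R$ have finite-dimensional Hilbert spaces $\mathcal H_A,\mathcal H_B,\dots$. $\mathscr D(\mathcal H)$ is the set of density operators on $\mathcal H$. $\mathrm{CPTP}(AE:B)$ (resp. $\mathrm{CP}(AE:B)$) is the set of completely positive trace-preserving (resp. completely positive) linear maps from operators on $\mathcal H_A\otimes\mathcal H_E$ to operators on $\mathcal H_B$. Such a map applied to an operator on $ARE$ acts as the identity on $R$. A quantum divergence is a functional $\mathbb D(\rho\|\sigma)\in\mathbb R\cup\{+\infty\}$, defined for all density operators $\rho$ and positive semidefinite operators $\sigma$ on a common (arbitrary finite-dimensional) Hilbert space, satisfying the data-processing inequality $\mathbb D(\mathcal E(\rho)\|\mathcal E(\sigma))\le\mathbb D(\rho\|\sigma)$ for every CPTP map $\mathcal E$. It has the direct-sum property if for every finite probability distribution $(p(x))_x$, density operators $\rho^{(x)}$ and positive semidefinite operators $\sigma^{(x)}$, with $\{|x\rangle\}$ an orthonormal basis, $$\mathbb D\Big(\sum_x p(x)|x\rangle\langle x|\otimes\rho^{(x)}\Big\|\sum_x p(x)|x\rangle\langle x|\otimes\sigma^{(x)}\Big)=\sum_x p(x)\,\mathbb D(\rho^{(x)}\|\sigma^{(x)}).$$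 Lower semicontinuity means that $(\rho,\sigma)\mapsto\mathbb D(\rho\|\sigma)$ is jointly lower semicontinuous on each finite-dimensional space. *)

(* Defs.v *)
From HB Require Import structures.
From mathcomp Require Import all_boot all_order all_algebra.
From mathcomp Require Import all_classical all_reals all_analysis.
From mathcomp Require Import complex mxtens.

Set Implicit Arguments.
Unset Strict Implicit.
Unset Printing Implicit Defensive.

Import Order.TTheory GRing.Theory Num.Theory.
Import numFieldNormedType.Exports.
Local Open Scope classical_set_scope.
Local Open Scope ring_scope.
Local Open Scope complex_scope.
Local Open Scope sesquilinear_scope.

(* The usual metric topology of the complex numbers: R[i] as a numFieldType,
   with the distance given by its norm. It induces the topology of
   'M[R[i]]_(m, n) used for lower semicontinuity. *)
HB.instance Definition _ (R : realType) :=
  PseudoPointedMetric.copy R[i] (R[i])^o.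

(* A quantum system of dimension n is C^n, its operators are 'M[R[i]]_n. In the
   order of R[i], 0 <= z means that z is real and nonnegative, so psd A implies
   that A is Hermitian. *)
Definition psd (R : realType) (n : nat) : set 'M[R[i]]_n :=
  [set A | forall v : 'cV[R[i]]_n, 0 <= (v ^t* *m A *m v) 0 0].

Definition density (R : realType) (n : nat) : set 'M[R[i]]_n :=
  [set A | psd A /\ \tr A = 1].

Arguments psd {R n}.
Arguments density {R n}.

(* For X on R (x) H, with R = C^r as the first factor, the operator
   (<i| (x) id) X (|j> (x) id) on H. *)
Definition block (R : realType) (r n : nat) (X : 'M[R[i]]_(r * n))
    (i j : 'I_r) : 'M[R[i]]_n :=
  mxsub (fun k => mxtens_index (i, k)) (fun l => mxtens_index (j, l)) X.

(* id_R (x) F *)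
Definition idtens (R : realType) (r m n : nat) (F : 'M[R[i]]_m -> 'M[R[i]]_n)
    (X : 'M[R[i]]_(r * m)) : 'M[R[i]]_(r * n) :=
  \sum_(i < r) \sum_(j < r) tensmx (delta_mx i j) (F (block X i j)).

(* tr_R, for the first factor R = C^r *)
Definition ptrace (R : realType) (r n : nat) (X : 'M[R[i]]_(r * n)) :
    'M[R[i]]_n :=
  \sum_(i < r) block X i i.

Definition cp (R : realType) (m n : nat)
    (F : {linear 'M[R[i]]_m -> 'M[R[i]]_n}) : Prop :=
  forall (r : nat) (X : 'M[R[i]]_(r * m)), psd X -> psd (idtens F X).

Definition cptp (R : realType) (m n : nat)
    (F : {linear 'M[R[i]]_m -> 'M[R[i]]_n}) : Prop :=
  cp F /\ forall X : 'M[R[i]]_m, \tr (F X) = \tr X.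

(* Only the values at (rho, sigma) with rho a density operator and sigma
   positive semidefinite are meaningful. *)
Definition functional (R : realType) : Type :=
  forall n : nat, 'M[R[i]]_n -> 'M[R[i]]_n -> \bar R.

Definition quantum_divergence (R : realType) (D : functional R) : Prop :=
  (forall (n : nat) (rho sigma : 'M[R[i]]_n),
     density rho -> psd sigma -> D n rho sigma != -oo%E) /\
  (forall (m n : nat) (F : {linear 'M[R[i]]_m -> 'M[R[i]]_n})
     (rho sigma : 'M[R[i]]_m),
     cptp F -> density rho -> psd sigma ->
     (D n (F rho) (F sigma) <= D m rho sigma)%E).

(* With p x = 0, the product p x * D(rho x, sigma x) is 0 even if
   D(rho x, sigma x) is infinite. *)
Definition direct_sum_property (R : realType) (D : functional R) : Prop :=
  forall (k n : nat) (p : 'I_k -> R) (rho sigma : 'I_k -> 'M[R[i]]_n),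
    (forall x, 0 <= p x) -> \sum_x p x = 1 ->
    (forall x, density (rho x)) -> (forall x, psd (sigma x)) ->
    D (k * n)%N (\sum_x (p x)%:C *: tensmx (delta_mx x x) (rho x))
                (\sum_x (p x)%:C *: tensmx (delta_mx x x) (sigma x))
    = (\sum_x (p x)%:E * D n (rho x) (sigma x))%E.

(* Joint lower semicontinuity for the relative topology of the domain of D (the
   points outside the domain are isolated in the subspace topology). *)
Definition divergence_lsc (R : realType) (D : functional R) : Prop :=
  forall n : nat,
    lower_semicontinuous
      ((fun rs => D n rs.1 rs.2) :
         subspace ((density : set 'M[R[i]]_n) `*` (psd : set 'M[R[i]]_n)) ->
         \bar R).

(* rho_{RA} (x) sigma_E as an operator on R (x) (A (x) E). The tensor factors of
   A R E are ordered R, A, E, so that a map AE -> B acts on the last two. *)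
Definition tensRAE (R : realType) (r a e : nat)
    (rho : 'M[R[i]]_(r * a)) (sigma : 'M[R[i]]_e) : 'M[R[i]]_(r * (a * e)) :=
  castmx (esym (mulnA r a e), esym (mulnA r a e)) (tensmx rho sigma).

Definition ketbra (R : realType) (n : nat) (psi : 'cV[R[i]]_n) : 'M[R[i]]_n :=
  psi *m psi ^t*.

(* psi in R (x) A, with R = C^r *)
Definition purification (R : realType) (r a : nat) (rho : 'M[R[i]]_a)
    (psi : 'cV[R[i]]_(r * a)) : Prop :=
  ptrace (ketbra psi) = rho.

(* D(N(rho_{AR} (x) sigma_E) || M(rho_{AR} (x) omega_E)) *)
Definition output_div (R : realType) (D : functional R) (a e b : nat)
    (N M : {linear 'M[R[i]]_(a * e) -> 'M[R[i]]_b}) (r : nat)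
    (rho : 'M[R[i]]_(r * a)) (sigma omega : 'M[R[i]]_e) : \bar R :=
  D (r * b)%N (idtens N (tensRAE rho sigma)) (idtens M (tensRAE rho omega)).

(* The supremum is over all dimensions r of the reference R and all states
   rho_{RA}; there is no state when r = 0. *)
Definition Dmx (R : realType) (D : functional R) (a e b : nat)
    (N M : {linear 'M[R[i]]_(a * e) -> 'M[R[i]]_b}) : \bar R :=
  ereal_sup (\bigcup_(r : nat)
    [set ereal_inf [set output_div D N M rho sigma omega
                   | sigma in density & omega in density]
    | rho in (density : set 'M[R[i]]_(r * a))]).

Lemma block_tens (R : realType) (r n : nat) (A : 'M[R[i]]_r) (B : 'M[R[i]]_n)
    (i j : 'I_r) : block (tensmx A B) i j = A i j *: B.
Proof. by apply/matrixP => k l; rewrite !mxE !mxtens_indexK. Qed.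

Lemma idtens_tens (R : realType) (r m n : nat)
    (F : {linear 'M[R[i]]_m -> 'M[R[i]]_n})
    (A : 'M[R[i]]_r) (B : 'M[R[i]]_m) :
  idtens F (tensmx A B) = tensmx A (F B).
Proof.
apply/matrixP => p q.
case: (mxtens_indexP p) => i k; case: (mxtens_indexP q) => j l.
rewrite tensmxE /idtens summxE (bigD1 i) //= summxE (bigD1 j) //=.
rewrite tensmxE mxE !eqxx mul1r block_tens linearZ mxE.
rewrite !big1 ?addr0 // => [i' ni|j' nj].
  rewrite summxE big1 // => j' _.
  by rewrite tensmxE mxE eq_sym (negbTE ni) mul0r.
by rewrite tensmxE mxE [j == _]eq_sym (negbTE nj) andbF mul0r.
Qed.

Lemma ptrace_tens (R : realType) (r n : nat)
    (A : 'M[R[i]]_r) (B : 'M[R[i]]_n) :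
  ptrace (tensmx A B) = \tr A *: B.
Proof.
by rewrite /ptrace /mxtrace scaler_suml; apply: eq_bigr => i _; rewrite block_tens.
Qed.

Lemma tensRAE_tens (R : realType) (r a e : nat)
    (A : 'M[R[i]]_r) (B : 'M[R[i]]_a) (S : 'M[R[i]]_e) :
  tensRAE (tensmx A B) S = tensmx A (tensmx B S).
Proof.
apply/matrixP => p q; case: (mxtens_indexP p) => i p'.
case: (mxtens_indexP p') => k s; case: (mxtens_indexP q) => j q'.
case: (mxtens_indexP q') => l t; rewrite castmxE !tensmxE mulrA.
rewrite -[in RHS](tensmxE A B) -tensmxE.
by congr (tensmx _ _ _ _); apply: val_inj; rewrite /= mulnDl mulnA addnA.
Qed.

(* Main.v *)
Require Import Defs.
From HB Require Import structures.
From mathcomp Require Import all_boot all_order all_algebra.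
From mathcomp Require Import all_classical all_reals all_analysis.
From mathcomp Require Import complex mxtens.
From mathcomp Require Import finmap ring lra.

(* A state of R (x) A with marginal rho_A is the image, under a channel on the
   reference alone, of any purification of rho_A; by data processing,
   purifications of dimension dA dominate all input states, which disposes of
   the suprema over R. The remaining point is the exchange of sup over rho_A and
   inf over (sigma, omega). The direct-sum property and data processing under a
   partial trace make the divergence jointly convex in (sigma, omega). It is also
   concave in rho_A: a mixture of pure inputs carrying a classical flag in the
   reference has as value the average of the values, and is dominated by the
   purification of its marginal. Density operators form a compact set, so Fan's
   minimax theorem applies, with lower semicontinuity in (sigma, omega) only and
   values in ]-oo, +oo]. *)

Set Implicit Arguments.
Unset Strict Implicit.
Unset Printing Implicit Defensive.

Import Order.TTheory GRing.Theory Num.Theory.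
Import numFieldNormedType.Exports.
Local Open Scope classical_set_scope.
Local Open Scope ring_scope.
Local Open Scope complex_scope.
Local Open Scope sesquilinear_scope.

(** * Fan's minimax theorem *)

(** Relative to [K], because nothing is known of a divergence outside its domain. *)
Definition lsc_on (R : realType) (T : topologicalType) (K : set T)
    (f : T -> \bar R) : Prop :=
  forall x a, K x -> (a%:E < f x)%E -> \forall y \near x, K y -> (a%:E < f y)%E.

Section LowerSemicontinuity.
Variables (R : realType) (T : topologicalType).
Implicit Types (K : set T) (f g : T -> \bar R).
Local Open Scope ereal_scope.

Lemma lsc_on_maxe K f g :
  lsc_on K f -> lsc_on K g -> lsc_on K (fun x => maxe (f x) (g x)).
Proof.
move=> lf lg x a Kx; rewrite lt_max => /orP[/(lf _ _ Kx)|/(lg _ _ Kx)];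
  by apply: filterS => y /[apply] h; rewrite lt_max h ?orbT.
Qed.

(** Each point has its own margin on a neighbourhood; compactness, as near covering along [d]
    tending to 0 from the right, yields one margin for all points. *)
Lemma compact_lsc_gt K f (c : R) : compact K -> lsc_on K f ->
  (forall x, K x -> c%:E < f x) ->
  exists2 d : R, (0 < d)%R & forall x, K x -> (c + d)%:E < f x.
Proof.
move=> /compact_near_coveringP/near_covering_withinP cK lf cf.
pose P (d : R) x := (c + d)%:E < f x.
have: \forall d \near 0^'+, K `<=` P d.
  apply: cK => x Kx.
  have [b cb bf] : exists2 b : R, (c < b)%R & b%:E < f x.
    have := cf _ Kx; case: (f x) => [r| |] //.
    - rewrite lte_fin => cr; exists ((c + r) / 2)%R; rewrite ?lte_fin; lra.
    - by move=> _; exists (c + 1)%R; [lra|rewrite ltry].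
  have [U Ux Ub] : exists2 U, nbhs x U & forall y, U y -> K y -> b%:E < f y.
    by exists [set y | K y -> b%:E < f y] => //; exact: lf.
  exists (U, [set d : R | (d < b - c)%R]) => /=.
    by split=> //; apply: nbhs_right_lt; rewrite subr_gt0.
  move=> [y d] /= [Uy db] Ky; apply: le_lt_trans (Ub _ Uy Ky).
  by rewrite lee_fin; lra.
move=> h; near (0%R : R)^'+ => d; exists d; first by near: d; exact: nbhs_right_gt.
suff : K `<=` P d by [].
by near: d; exact: h.
Unshelve. all: by end_near.
Qed.

(** The same covering argument, along [b] tending to +oo. Every larger [b] is allowed, so that the
    bounds of two functions can be merged. *)
Lemma compact_lsc_lbound K f : compact K -> lsc_on K f ->
  (forall x, K x -> f x != -oo) ->
  exists B : R, forall b : R, (B < b)%R -> forall x, K x -> (- b)%:E < f x.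
Proof.
move=> /compact_near_coveringP/near_covering_withinP cK lf fNy.
pose P (b : R) x := (- b)%:E < f x.
have: \forall b \near +oo%R, K `<=` P b.
  apply: cK => x Kx.
  have [b bf] : exists b : R, b%:E < f x.
    have := fNy _ Kx; case: (f x) => [r| |] // _.
    - by exists (r - 1)%R; rewrite lte_fin; lra.
    - by exists 0%R; rewrite ltry.
  have [U Ux Ub] : exists2 U, nbhs x U & forall y, U y -> K y -> b%:E < f y.
    by exists [set y | K y -> b%:E < f y] => //; exact: lf.
  exists (U, [set d : R | (- b < d)%R]) => /=.
    by split=> //; apply: nbhs_pinfty_gt; rewrite num_real.
  move=> [y d] /= [Uy db] Ky; apply: le_lt_trans (Ub _ Uy Ky).
  by rewrite lee_fin; lra.
by case=> B [_ h]; exists B => b Bb x Kx; exact: (h b Bb).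
Qed.

(** A filter on the sublevel set clusters at some [x] in [K]; if [f x] exceeded [c], so would [f] on
    [K] near [x], and the sublevel set would miss a neighbourhood of its cluster point. *)
Lemma compact_lsc_sublevel K f (c : R) : compact K -> lsc_on K f ->
  compact (K `&` [set x | f x <= c%:E]).
Proof.
move=> cK lf F PF FKc.
have [x [Kx clx]] : K `&` cluster F !=set0.
  by apply: cK; apply: filterS FKc => ? [].
exists x; split => //; split => //=; rewrite leNgt; apply/negP => cfx.
have [y [[Ky fyc] /(_ Ky)]] := clx _ _ FKc (lf _ _ Kx cfx).
by rewrite ltNge fyc.
Qed.

End LowerSemicontinuity.

Lemma lsc_on_subset (R : realType) (T : topologicalType) (K L : set T)
  (f : T -> \bar R) : L `<=` K -> lsc_on K f -> lsc_on L f.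
Proof.
by move=> LK lf x a /LK Kx /(lf _ _ Kx); apply: filterS => y + /LK; apply.
Qed.

Section Minimax.
Variables (R : realType) (T : topologicalType).
Local Open Scope ereal_scope.

(* Two-function case. If f and g have no common point at level c, compactness
   gives margins d and B such that max(f, g) > c + d and f, g > c' - B on K, with
   c' = c + d/2. By convexity some line s u + v = 0 lies below the set V of the
   pairs (f x - c', g x - c') of finite values, and the margins keep its slope s
   within [e/B, B/e]. So both weights are positive, hence points where f or g is
   +oo satisfy the bound trivially, and t f + (1 - t) g >= c' > c on K. *)
Lemma convexlike_common_sublevel (K : set T) (f g : T -> \bar R) (c : R) :
  compact K -> lsc_on K f -> lsc_on K g ->
  (forall x, K x -> f x != -oo) -> (forall x, K x -> g x != -oo) ->
  (forall x y (t : R), K x -> K y -> (0 < t < 1)%R -> exists z,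
    [/\ K z, f z <= t%:E * f x + (1 - t)%:E * f y
           & g z <= t%:E * g x + (1 - t)%:E * g y]) ->
  (forall t : R, (0 < t < 1)%R ->
    exists2 x, K x & t%:E * f x + (1 - t)%:E * g x <= c%:E) ->
  exists x, [/\ K x, f x <= c%:E & g x <= c%:E].
Proof.
move=> cK lf lg fNy gNy fg_conv fg_le; apply: contrapT => nfg.
have [d d0 fg_gt] : exists2 d : R, (0 < d)%R &
    forall x, K x -> (c + d)%:E < maxe (f x) (g x).
  apply: compact_lsc_gt => //; first exact: lsc_on_maxe.
  move=> x Kx; rewrite ltNge ge_max; apply/negP => /andP[fc gc].
  by apply: nfg; exists x.
(* One half of [d] makes the level c' of the final contradiction strictly larger than [c]; the other
   half keeps [V] away from the quadrant u, v <= 0. *)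
pose e := (d / 2)%R; have e0 : (0 < e)%R by rewrite divr_gt0.
pose c' := (c + e)%R.
have cde : (c + d = c' + e)%R by rewrite /c' /e; lra.
have [B [eB fB gB]] : exists B : R, [/\ (e < B)%R,
    forall x, K x -> (c' - B)%:E < f x & forall x, K x -> (c' - B)%:E < g x].
  have [B1 B1P] := compact_lsc_lbound cK lf fNy.
  have [B2 B2P] := compact_lsc_lbound cK lg gNy.
  pose B := (`|B1| + `|B2| + `|c'| + e + 1)%R.
  have := normr_ge0 B1; have := normr_ge0 B2; have := normr_ge0 c'.
  have := ler_norm B1; have := ler_norm B2; have := ler_norm c' => *.
  exists B; split; first by rewrite /B; lra.
  - by move=> x Kx; rewrite -[(c' - B)%R]opprK; apply: B1P Kx; rewrite /B; lra.
  - by move=> x Kx; rewrite -[(c' - B)%R]opprK; apply: B2P Kx; rewrite /B; lra.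
have B0 : (0 < B)%R by apply: lt_trans eB.
pose V u v := exists x, [/\ K x, f x = (c' + u)%:E & g x = (c' + v)%:E].
have Ve u v : V u v -> (e < u)%R \/ (e < v)%R.
  move=> [x [Kx fx gx]]; have := fg_gt _ Kx.
  rewrite fx gx cde lt_max !lte_fin !ltrD2l => /orP[]; tauto.
have VB u v : V u v -> (- B < u)%R /\ (- B < v)%R.
  move=> [x [Kx fx gx]]; have := fB _ Kx; have := gB _ Kx.
  by rewrite fx gx !lte_fin !ltrD2l.
(* Otherwise the segment joining the two points meets the axis u = 0 at a negative v, and convexity
   gives a point of [K] where both functions are at most c'. *)
have cross u1 v1 u2 v2 : V u1 v1 -> V u2 v2 -> (u1 < 0)%R -> (v2 <= 0)%R ->
    (u1 * v2 <= v1 * u2)%R.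
  move=> V1 V2 u10 v20; rewrite leNgt; apply/negP => uv.
  have u20 : (0 < u2)%R by case: (Ve _ _ V2); lra.
  pose t := (u2 / (u2 - u1))%R; have u21 : (0 < u2 - u1)%R by lra.
  have t01 : (0 < t < 1)%R.
    by rewrite divr_gt0 //= ltr_pdivrMr //; lra.
  case: V1 => x1 [Kx1 fx1 gx1]; case: V2 => x2 [Kx2 fx2 gx2].
  have [z [Kz]] := fg_conv _ _ _ Kx1 Kx2 t01.
  rewrite fx1 fx2 gx1 gx2 -!EFinM -!EFinD.
  have -> : (t * (c' + u1) + (1 - t) * (c' + u2) = c')%R by rewrite /t; field; lra.
  have -> : (t * (c' + v1) + (1 - t) * (c' + v2) =
             c' + (u2 * v1 - u1 * v2) / (u2 - u1))%R by rewrite /t; field; lra.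
  move=> fz gz; have := fg_gt _ Kz; apply/negP; rewrite -leNgt ge_max.
  rewrite (le_trans fz) ?lee_fin; last by rewrite cde; lra.
  rewrite (le_trans gz) ?lee_fin // cde lerD2l (@le_trans _ _ 0%R) //; last by lra.
  by rewrite ler_pdivrMr // mul0r; lra.
(* Points with v <= 0 bound the slope from below by -v/u, points with u < 0 from above by v/(-u),
   and [cross] compares the two kinds. The element [e / B] makes [S] nonempty and its supremum
   positive. *)
pose S : set R := [set (e / B)%R] `|`
  [set s | exists u v, [/\ V u v, (v <= 0)%R & s = (- v / u)%R]].
have S0 : S (e / B)%R by left.
have eB1 : (e / B <= B / e)%R.
  apply: (@le_trans _ _ 1%R); first by rewrite ler_pdivrMr //; lra.
  by rewrite ler_pdivlMr //; lra.
have Sub : ubound S (B / e)%R.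
  move=> _ [->//|[u [v [Vuv v0 ->]]]].
  have [_ vB] := VB _ _ Vuv; have eu : (e < u)%R by case: (Ve _ _ Vuv); lra.
  apply: ler_pM; [lra|by rewrite invr_ge0; lra|lra|].
  by rewrite lef_pV2 ?posrE; lra.
have Shas : has_sup S by split; [exists (e / B)%R|exists (B / e)%R].
pose s := sup S.
have s0 : (0 < s)%R.
  by apply: (@lt_le_trans _ _ (e / B)%R); [rewrite divr_gt0|apply: sup_upper_bound].
have sV u v : V u v -> (0 <= s * u + v)%R.
  move=> Vuv; have [v0|v0] := leP v 0%R.
    have u0 : (0 < u)%R by case: (Ve _ _ Vuv); lra.
    have : (- v / u <= s)%R by apply: sup_upper_bound => //; right; exists u, v.
    by rewrite ler_pdivrMr //; lra.
  have [u0|u0] := leP 0%R u; first by have := mulr_ge0 (ltW s0) u0; lra.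
  have : (s <= v / - u)%R.
    apply: ge_sup; first by exists (e / B)%R.
    have [uB vB] := VB _ _ Vuv.
    have ev : (e < v)%R by case: (Ve _ _ Vuv); lra.
    move=> _ [->|[u' [v' [Vuv' v'0 ->]]]].
      by apply: ler_pM; [lra|by rewrite invr_ge0; lra|lra|]; rewrite lef_pV2 ?posrE; lra.
    have u'0 : (0 < u')%R by case: (Ve _ _ Vuv'); lra.
    have := cross _ _ _ _ Vuv Vuv' u0 v'0.
    rewrite ler_pdivrMr // mulrAC ler_pdivlMr; lra.
  by rewrite ler_pdivlMr; lra.
(* The weights s and 1 of the line, normalized to sum 1. *)
pose t := (s / (1 + s))%R.
have s1 : (0 < 1 + s)%R by lra.
have t01 : (0 < t < 1)%R by rewrite divr_gt0 //= ltr_pdivrMr //; lra.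
have [t0 t1] : (0 < t /\ 0 < 1 - t)%R by lra.
have [x Kx] := fg_le _ t01; have := fNy _ Kx; have := gNy _ Kx.
case fx: (f x) => [u| |] //; case gx: (g x) => [v| |] // _ _; last 3 first.
- by rewrite (gt0_muley (x := (1 - t)%:E)).
- by rewrite (gt0_muley (x := t%:E)).
- by rewrite (gt0_muley (x := t%:E)) // (gt0_muley (x := (1 - t)%:E)).
rewrite -!EFinM -EFinD lee_fin; apply/negP; rewrite -ltNge.
have := sV (u - c')%R (v - c')%R; rewrite /V => h.
have {h} h : (0 <= s * (u - c') + (v - c'))%R.
  by apply: h; exists x; rewrite fx gx; split=> //; congr (_%:E); ring.
apply: (@lt_le_trans _ _ c'); first by rewrite /c'; lra.
rewrite -subr_ge0.
have -> : (t * u + (1 - t) * v - c' = (s * (u - c') + (v - c')) / (1 + s))%R.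
  by rewrite /t; field; lra.
by rewrite divr_ge0 //; lra.
Qed.

Variables (Y : choiceType) (f : T -> Y -> \bar R) (Ys : set Y).

(* Fan's notions, which make sense without a linear structure. *)
Definition convexlike (K : set T) := forall x x' (t : R), K x -> K x' ->
  (0 < t < 1)%R -> exists2 z, K z &
    forall y, Ys y -> f z y <= t%:E * f x y + (1 - t)%:E * f x' y.

Definition concavelike (K : set T) := forall y y' (t : R), Ys y -> Ys y' ->
  (0 < t < 1)%R -> exists2 z, Ys z &
    forall x, K x -> t%:E * f x y + (1 - t)%:E * f x y' <= f x z.

(** Induction on [l], shrinking [K] to the sublevel set of [y0], which stays compact and convexlike.
    That each other [y] still reaches level [c] there is the two-function case: its hypothesis on
    the combinations of [f^~ y0] and [f^~ y] holds because concavity bounds each of them by a single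
    [f^~ y']. *)
Lemma finite_common_sublevel (c : R) (l : seq Y) (K : set T) :
  K !=set0 -> compact K -> (forall y, Ys y -> lsc_on K (f^~ y)) ->
  (forall x y, K x -> Ys y -> f x y != -oo) -> convexlike K ->
  concavelike K ->
  (forall y, Ys y -> exists2 x, K x & f x y <= c%:E) ->
  (forall y, y \in l -> Ys y) ->
  exists2 x, K x & forall y, y \in l -> f x y <= c%:E.
Proof.
elim: l K => [|y0 l IHl] K [x0 Kx0] cK lf fNy f_conv f_conc f_le lYs.
  by exists x0.
have Yy0 : Ys y0 by apply: lYs; rewrite mem_head.
have lYs' y : y \in l -> Ys y by move=> yl; apply: lYs; rewrite in_cons yl orbT.
pose K' := K `&` [set x | f x y0 <= c%:E].
have K'K : K' `<=` K by move=> ? [].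
have [||||||||x [Kx xy0] xl] := IHl K'.
- by have [x Kx xc] := f_le _ Yy0; exists x.
- by apply: (compact_lsc_sublevel cK); exact: lf.
- by move=> y Yy; apply: lsc_on_subset K'K _; exact: lf.
- by move=> x y /K'K Kx; exact: fNy.
- move=> x x' t [Kx xc] [Kx' x'c] t01.
  have [z Kz zf] := f_conv _ _ _ Kx Kx' t01; exists z => //; split => //=.
  rewrite (le_trans (zf _ Yy0)) //.
  have -> : c%:E = t%:E * c%:E + (1 - t)%:E * c%:E.
    by rewrite -!EFinM -EFinD; congr (_%:E); ring.
  by rewrite leeD // lee_pmul2l // ?lte_fin; lra.
- move=> y y' t Yy Yy' t01; have [z Yz zf] := f_conc _ _ _ Yy Yy' t01.
  by exists z => // x /K'K; exact: zf.
- move=> y Yy.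
  have [||||x [Kx xy0 xy]] :=
      @convexlike_common_sublevel K (f^~ y0) (f^~ y) c cK (lf _ Yy0) (lf _ Yy).
  + by move=> x Kx; exact: fNy.
  + by move=> x Kx; exact: fNy.
  + move=> x x' t Kx Kx' t01; have [z Kz zf] := f_conv _ _ _ Kx Kx' t01.
    by exists z; split => //; exact: zf.
  + move=> t t01; have [y' Yy' y'f] := f_conc _ _ _ Yy0 Yy t01.
    have [x Kx xy'] := f_le _ Yy'; exists x => //.
    exact: le_trans (y'f _ _) xy'.
  + by exists x.
- exact: lYs'.
exists x => // y; rewrite in_cons => /predU1P[->//|]; exact: xl.
Qed.

(** Compactness along the finite subsets of [Y] directed by inclusion: if every point of [K]
    violated the bound for some index, one finite set of indices would exhibit a violation at every
    point, against the finite case. *)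
Lemma common_sublevel (c : R) (K : set T) :
  K !=set0 -> compact K -> (forall y, Ys y -> lsc_on K (f^~ y)) ->
  (forall x y, K x -> Ys y -> f x y != -oo) -> convexlike K ->
  concavelike K ->
  (forall y, Ys y -> exists2 x, K x & f x y <= c%:E) ->
  exists2 x, K x & forall y, Ys y -> f x y <= c%:E.
Proof.
move=> K0 cK lf fNy f_conv f_conc f_le; apply: contrapT => nx.
pose F := filter_from [set: {fset Y}]
  (fun A => [set B : {fset Y} | {subset A <= B}]).
have FF : Filter F.
  apply: filter_from_filter; first by exists fset0.
  move=> A B _ _; exists (A `|` B)%fset => // C ABC /=; split=> y yAB;
  by apply: ABC; rewrite inE yAB ?orbT.
pose P (A : {fset Y}) x := exists y, [/\ y \in A, Ys y & c%:E < f x y].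
have : \near F, K `<=` P F.
  have /compact_near_coveringP/near_covering_withinP := cK; apply => x Kx.
  have [y [Yy yc]] : exists y, Ys y /\ c%:E < f x y.
    apply: contrapT => ny; apply: nx; exists x => // y Yy.
    by rewrite leNgt; apply/negP => cy; apply: ny; exists y.
  exists ([set x' | K x' -> c%:E < f x' y], [set B : {fset Y} | y \in B]) => /=.
    split; first exact: (lf _ Yy _ _ Kx yc).
    by exists [fset y]%fset => // B; apply; rewrite inE.
  by move=> [x' B] /= [x'y yB] Kx'; exists y; split=> //; exact: x'y.
move=> [A _ /(_ A (fun _ => id)) /= KA].
(* [A] may contain indices outside [Ys]; these are dropped. *)
have [|x Kx xA] := @finite_common_sublevel c [seq y <- enum_fset A | `[< Ys y >]] K
    K0 cK lf fNy f_conv f_conc f_le.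
  by move=> y; rewrite mem_filter => /andP[/asboolP].
have [y [yA Yy]] := KA _ Kx; apply/negP; rewrite -leNgt.
by apply: xA; rewrite mem_filter yA andbT; exact/asboolP.
Qed.

(** If the inequality sup inf <= inf sup were strict, a real [c] strictly in between would be
    reached for each [y] separately, hence by one point for all [y], which bounds the right side by
    [c]. *)
Theorem minimax (K : set T) :
  K !=set0 -> compact K -> (forall y, Ys y -> lsc_on K (f^~ y)) ->
  (forall x y, K x -> Ys y -> f x y != -oo) -> convexlike K ->
  concavelike K ->
  ereal_sup [set ereal_inf [set f x y | x in K] | y in Ys] =
  ereal_inf [set ereal_sup [set f x y | y in Ys] | x in K].
Proof.
move=> K0 cK lf fNy f_conv f_conc; apply/eqP; rewrite eq_le; apply/andP; split.
  apply: ge_ereal_sup => _ [y Yy <-]; apply: le_ereal_inf_tmp => _ [x Kx <-].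
  by apply: (@le_trans _ _ (f x y));
    [apply: ereal_inf_lbound; exists x|apply: ereal_sup_ubound; exists y].
set v := ereal_sup _; rewrite leNgt; apply/negP => vlt.
have [c vc cw] : exists2 c : R, v < c%:E &
    c%:E < ereal_inf [set ereal_sup [set f x y | y in Ys] | x in K].
  move: vlt; move: v (ereal_inf _) => [a| |] [b| |] //.
  - by rewrite lte_fin => ab; exists ((a + b) / 2)%R; rewrite lte_fin; lra.
  - by exists (a + 1)%R; rewrite ?ltry // lte_fin; lra.
  - by exists (b - 1)%R; rewrite ?ltNyr // lte_fin; lra.
  - by exists 0%R; rewrite ?ltNyr ?ltry.
have [y Yy|x Kx xc] := @common_sublevel c K K0 cK lf fNy f_conv f_conc.
  have : ereal_inf [set f x y | x in K] < c%:E.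
    by apply: le_lt_trans vc; apply: ereal_sup_ubound; exists y.
  by move=> /ereal_inf_lt[_ [x Kx <-] /ltW]; exists x.
move: cw; apply/negP; rewrite -leNgt.
apply: (@le_trans _ _ (ereal_sup [set f x y | y in Ys])).
  by apply: ereal_inf_lbound; exists x.
by apply: ge_ereal_sup => _ [y Yy <-]; exact: xc.
Qed.

End Minimax.

(** * Positive semidefinite matrices and tensor products *)

Section Adjoint.
Variable C : numClosedFieldType.

Lemma adjmxM m n p (A : 'M[C]_(m, n)) (B : 'M[C]_(n, p)) :
  (A *m B) ^t* = B ^t* *m A ^t*.
Proof. by rewrite trmx_mul map_mxM. Qed.

Lemma adjmxD m n (A B : 'M[C]_(m, n)) : (A + B) ^t* = A ^t* + B ^t*.
Proof. by rewrite linearD /= map_mxD. Qed.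

Lemma adjmxN m n (A : 'M[C]_(m, n)) : (- A) ^t* = - A ^t*.
Proof. by rewrite linearN /= map_mxN. Qed.

Lemma adjmxZ m n a (A : 'M[C]_(m, n)) : (a *: A) ^t* = a^* *: A ^t*.
Proof. by rewrite linearZ /= map_mxZ. Qed.

Lemma adjmx1 n : (1%:M : 'M[C]_n) ^t* = 1%:M.
Proof. by rewrite trmx1 map_mx1. Qed.

Lemma adjmx_tens m n p q (A : 'M[C]_(m, n)) (B : 'M[C]_(p, q)) :
  (tensmx A B) ^t* = tensmx (A ^t*) (B ^t*).
Proof. by rewrite trmx_tens map_mxT. Qed.

Lemma mxtrace_gram_ge0 m n (A : 'M[C]_(m, n)) : 0 <= \tr (A ^t* *m A).
Proof.
apply: sumr_ge0 => j _; rewrite mxE; apply: sumr_ge0 => k _.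
by rewrite !mxE mulrC mul_conjC_ge0.
Qed.

Lemma mxtrace_gram_eq0 m n (A : 'M[C]_(m, n)) :
  \tr (A ^t* *m A) = 0 -> A = 0.
Proof.
move=> A0; apply/matrixP => i j; rewrite mxE.
have ge0 (k : 'I_m) (l : 'I_n) : 0 <= (A ^t*) l k * A k l.
  by rewrite !mxE mulrC mul_conjC_ge0.
have /(_ j isT) : forall l, true -> (A ^t* *m A) l l = 0.
  move=> l _; apply: (psumr_eq0P _ A0) => // k _.
  by rewrite mxE; apply: sumr_ge0.
rewrite mxE => /psumr_eq0P /(_ i isT); rewrite !mxE => /(_ (fun k _ => ge0 k j)).
by move/eqP; rewrite mulrC mul_conjC_eq0 => /eqP.
Qed.

End Adjoint.

Section Psd.
Variable R : realType.
Local Notation C := R[i].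

Lemma psd_gram m n (A : 'M[C]_(n, m)) : psd (A *m A ^t*).
Proof.
move=> v; set w := A ^t* *m v.
have -> : v ^t* *m (A *m A ^t*) *m v = w ^t* *m w.
  by rewrite adjmxM trmxCK !mulmxA.
have -> : (w ^t* *m w) 0 0 = \tr (w ^t* *m w) by rewrite /mxtrace big_ord1.
exact: mxtrace_gram_ge0.
Qed.

Lemma psd_congr m n (K : 'M[C]_(m, n)) (A : 'M[C]_n) :
  psd A -> psd (K *m A *m K ^t*).
Proof.
move=> pA v; have := pA (K ^t* *m v).
by rewrite adjmxM trmxCK !mulmxA.
Qed.

Lemma psd0 n : psd (0 : 'M[C]_n).
Proof. by move=> v; rewrite mulmx0 mul0mx mxE. Qed.

Lemma psdD n (A B : 'M[C]_n) : psd A -> psd B -> psd (A + B).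
Proof.
by move=> pA pB v; rewrite mulmxDr mulmxDl mxE addr_ge0 ?pA ?pB.
Qed.

Lemma psd_sum n I (r : seq I) (P : pred I) (F : I -> 'M[C]_n) :
  (forall i, P i -> psd (F i)) -> psd (\sum_(i <- r | P i) F i).
Proof. by move=> pF; elim/big_ind: _ => //; [exact: psd0|exact: psdD]. Qed.

Lemma psdZ n (c : C) (A : 'M[C]_n) : 0 <= c -> psd A -> psd (c *: A).
Proof.
by move=> c0 pA v; rewrite -scalemxAr -scalemxAl mxE mulr_ge0 ?pA.
Qed.

(** The quadratic form of [A] is real, so that of [H], the adjoint of [A] minus [A], vanishes;
    polarization with the scalars 1 and i then kills the sesquilinear form of [H]. *)
Lemma psd_hermitian n (A : 'M[C]_n) : psd A -> A ^t* = A.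
Proof.
move=> pA; apply/eqP; rewrite -subr_eq0; apply/eqP; set H := _ - _.
have H0 (v : 'cV_n) : v ^t* *m H *m v = 0.
  have -> : v ^t* *m H *m v = (v ^t* *m A *m v) ^t* - v ^t* *m A *m v.
    by rewrite mulmxBr mulmxBl !adjmxM trmxCK !mulmxA.
  have vA : (v ^t* *m A *m v) 0 0 \is Num.real by exact/ger0_real/pA.
  move: (v ^t* *m A *m v) vA => X /CrealP XE.
  by apply/matrixP => i j; rewrite !ord1 !mxE XE subrr.
move: H H0 => H H0.
have Hpol (u w : 'cV[C]_n) : u ^t* *m H *m w = 0.
  have h (c : C) : c *: (u ^t* *m H *m w) + c^* *: (w ^t* *m H *m u) = 0.
    have := H0 (u + c *: w).
    rewrite adjmxD adjmxZ !mulmxDl !mulmxDr -!scalemxAl -!scalemxAr !H0.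
    by rewrite !scaler0 add0r addr0.
  have := h 1; rewrite conjC1 !scale1r => /eqP; rewrite addr_eq0 => /eqP h1.
  have := h 'i%R; rewrite conjCi h1 scalerN scaleNr -opprD => /eqP.
  rewrite oppr_eq0 -scalerDl scaler_eq0 -mulr2n mulrn_eq0 /= (negbTE (neq0Ci _)) /=.
  by move=> /eqP ->; rewrite oppr0.
apply/matrixP => i j; rewrite [RHS]mxE.
have := congr1 (fun X : 'M[C]_1 => X 0 0) (Hpol (delta_mx i 0) (delta_mx j 0)).
rewrite [RHS]mxE => <-.
by rewrite trmx_delta map_delta_mx -rowE -colE !mxE.
Qed.

(** Spectral theorem: testing [A] on the eigenvectors shows that the eigenvalues are nonnegative,
    and [B] carries their square roots. *)
Lemma psd_gramP n (A : 'M[C]_n) :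
  psd A -> exists B : 'M[C]_n, A = B *m B ^t*.
Proof.
move=> pA; have : A \is normalmx by apply/normalmxP; rewrite psd_hermitian.
move/orthomx_spectralP; set U := spectralmx A; set d := spectral_diag A => AE.
have Uu : U \is unitarymx by exact: spectral_unitarymx.
rewrite invmx_unitary // in AE.
have UU := unitarymxP Uu.
have d0 i : 0 <= d 0 i.
  have := pA (U ^t* *m delta_mx i 0); rewrite AE adjmxM trmxCK.
  rewrite !mulmxA -[_ *m U *m _]mulmxA UU mulmx1.
  rewrite -!mulmxA (mulmxA U) UU mul1mx.
  by rewrite trmx_delta map_delta_mx mulmxA -rowE -colE !mxE eqxx mulr1n.
exists (U ^t* *m diag_mx (map_mx sqrtC d)).
rewrite adjmxM trmxCK tr_diag_mx map_diag_mx mulmxA -(mulmxA (U ^t*)).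
rewrite mulmx_diag [LHS]AE; congr (_ *m diag_mx _ *m _).
apply/rowP => i; rewrite !mxE.
apply: etrans (normCK _); rewrite ger0_norm ?sqrtC_ge0 ?d0 //.
by rewrite sqrtCK.
Qed.

Lemma psd_tens m n (A : 'M[C]_m) (B : 'M[C]_n) :
  psd A -> psd B -> psd (tensmx A B).
Proof.
move=> /psd_gramP[A' ->] /psd_gramP[B' ->].
by rewrite -tensmx_mul -adjmx_tens; exact: psd_gram.
Qed.

End Psd.

(** * Operators on a reference tensor a system, as block matrices *)

Section Blocks.
Variable R : realType.
Local Notation C := R[i].

(** Serves maps such as [block], [tensmx] and [tensRAE], whose linearity in one argument is
    available as a proposition rather than as a structure. *)
Lemma linear_sumZ (U V : lmodType C) (f : U -> V) I (s : seq I) (P : pred I)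
    (c : I -> C) (F : I -> U) : linear f ->
  f (\sum_(i <- s | P i) c i *: F i) = \sum_(i <- s | P i) c i *: f (F i).
Proof.
move=> lf; pose g : {linear U -> V} :=
  HB.pack f (GRing.isLinear.Build C U V *:%R f lf).
rewrite -[f]/(g : U -> V) linear_sum; apply: eq_bigr => i _; exact: linearZ.
Qed.

Lemma linear_sumE (U V : lmodType C) (f : U -> V) I (s : seq I) (P : pred I)
    (F : I -> U) : linear f ->
  f (\sum_(i <- s | P i) F i) = \sum_(i <- s | P i) f (F i).
Proof.
move=> lf; have := linear_sumZ s P (fun=> 1) F lf.
by under eq_bigr do rewrite scale1r; under [RHS]eq_bigr do rewrite scale1r.
Qed.

Lemma blockE r n (X : 'M[C]_(r * n)) i j k l :
  block X i j k l = X (mxtens_index (i, k)) (mxtens_index (j, l)).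
Proof. by rewrite mxE. Qed.

(** Maps acting as the identity on the reference act on each block separately, so identities between
    them reduce to the system alone. *)
Lemma blockP r n (X Y : 'M[C]_(r * n)) :
  (forall i j, block X i j = block Y i j) -> X = Y.
Proof.
move=> XY; apply/matrixP => p q.
case: (mxtens_indexP p) => i k; case: (mxtens_indexP q) => j l.
by rewrite -!blockE XY.
Qed.

Lemma block_linear r n i j : linear (fun X : 'M[C]_(r * n) => block X i j).
Proof. by move=> c X Y; apply/matrixP => k l; rewrite !mxE. Qed.

Lemma block_idtens r m n (F : {linear 'M[C]_m -> 'M[C]_n}) (X : 'M[C]_(r * m))
  i j : block (idtens F X) i j = F (block X i j).
Proof.
apply/matrixP => k l; rewrite blockE /idtens summxE (bigD1 i) //= summxE.
rewrite (bigD1 j) //= tensmxE mxE !eqxx mul1r !big1 ?addr0 // => [i' ni|j' nj].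
  rewrite summxE big1 // => j' _.
  by rewrite tensmxE mxE eq_sym (negbTE ni) mul0r.
by rewrite tensmxE mxE [j == _]eq_sym (negbTE nj) andbF mul0r.
Qed.

Lemma idtens_linear r m n (F : {linear 'M[C]_m -> 'M[C]_n}) :
  linear (@idtens R r m n F).
Proof.
move=> c X Y; apply: blockP => i j.
by rewrite !(block_idtens, block_linear) linearP.
Qed.

HB.instance Definition _ r m n (F : {linear 'M[C]_m -> 'M[C]_n}) :=
  GRing.isLinear.Build C 'M[C]_(r * m) 'M[C]_(r * n) _ (@idtens R r m n F)
    (idtens_linear F).

Lemma block_tensRAE r a e (rho : 'M[C]_(r * a)) (sigma : 'M[C]_e) i j :
  block (tensRAE rho sigma) i j = tensmx (block rho i j) sigma.
Proof.
apply/matrixP => p q; case: (mxtens_indexP p) => k s.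
case: (mxtens_indexP q) => l t; rewrite blockE castmxE tensmxE blockE -tensmxE.
(* Both nestings of the index triple have the value i a e + k e + s, so the cast for associativity
   moves no entry. *)
by congr (tensmx _ _ _ _); apply: val_inj; rewrite /= mulnDl mulnA addnA.
Qed.

Lemma tensmx_linearl m n p q (B : 'M[C]_(p, q)) :
  linear (fun A : 'M[C]_(m, n) => tensmx A B).
Proof. by move=> c A A'; apply/matrixP => i j; rewrite !mxE mulrDl mulrA. Qed.

Lemma tensmx_linearr m n p q (A : 'M[C]_(m, n)) :
  linear (fun B : 'M[C]_(p, q) => tensmx A B).
Proof. by move=> c B B'; apply/matrixP => i j; rewrite !mxE mulrDr mulrCA. Qed.

Lemma tensRAE_linearl r a e (sigma : 'M[C]_e) :
  linear (fun rho : 'M[C]_(r * a) => tensRAE rho sigma).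
Proof.
move=> c X Y; apply: blockP => i j.
by rewrite !(block_tensRAE, block_linear) tensmx_linearl.
Qed.

Lemma tensRAE_linearr r a e (rho : 'M[C]_(r * a)) :
  linear (fun sigma : 'M[C]_e => tensRAE rho sigma).
Proof.
move=> c X Y; apply: blockP => i j.
by rewrite !(block_tensRAE, block_linear) tensmx_linearr.
Qed.

Lemma sum_mxtens (V : nmodType) m n (F : 'I_(m * n) -> V) :
  \sum_p F p = \sum_i \sum_k F (mxtens_index (i, k)).
Proof.
rewrite pair_bigA /= (reindex (@mxtens_index m n)) /=; last first.
  by exists (@mxtens_unindex m n) => p _; rewrite ?mxtens_indexK ?mxtens_unindexK.
by apply: eq_bigr => -[i k].
Qed.

Lemma mxtrace_blocks r n (X : 'M[C]_(r * n)) : \tr X = \sum_i \tr (block X i i).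
Proof.
rewrite /mxtrace sum_mxtens; apply: eq_bigr => i _.
by apply: eq_bigr => k _; rewrite mxE.
Qed.

Lemma mxtrace_idtens r m n (F : {linear 'M[C]_m -> 'M[C]_n}) (X : 'M[C]_(r * m)) :
  (forall Y, \tr (F Y) = \tr Y) -> \tr (idtens F X) = \tr X.
Proof.
move=> trF; rewrite !mxtrace_blocks; apply: eq_bigr => i _.
by rewrite block_idtens trF.
Qed.

Lemma mxtrace_tens m n (A : 'M[C]_m) (B : 'M[C]_n) :
  \tr (tensmx A B) = \tr A * \tr B.
Proof.
rewrite mxtrace_blocks {2}/mxtrace mulr_suml; apply: eq_bigr => i _.
by rewrite block_tens mxtraceZ.
Qed.

Lemma mxtrace_tensRAE r a e (rho : 'M[C]_(r * a)) (sigma : 'M[C]_e) :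
  \tr (tensRAE rho sigma) = \tr rho * \tr sigma.
Proof.
rewrite !mxtrace_blocks mulr_suml; apply: eq_bigr => i _.
by rewrite block_tensRAE mxtrace_tens.
Qed.

Lemma psd_castmx n m (e : n = m) (X : 'M[C]_n) : psd X -> psd (castmx (e, e) X).
Proof. by case: m / e; rewrite castmx_id. Qed.

Lemma psd_tensRAE r a e (rho : 'M[C]_(r * a)) (sigma : 'M[C]_e) :
  psd rho -> psd sigma -> psd (tensRAE rho sigma).
Proof. by move=> prho psigma; apply/psd_castmx/psd_tens. Qed.

Lemma density_tensRAE r a e (rho : 'M[C]_(r * a)) (sigma : 'M[C]_e) :
  density rho -> density sigma -> density (tensRAE rho sigma).
Proof.
move=> [prho trho] [psigma tsigma]; split; first exact: psd_tensRAE.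
by rewrite mxtrace_tensRAE trho tsigma mulr1.
Qed.

Lemma density_idtens r m n (F : {linear 'M[C]_m -> 'M[C]_n}) (X : 'M[C]_(r * m)) :
  cptp F -> density X -> density (idtens F X).
Proof.
move=> [cpF trF] [pX tX]; split; first exact: cpF.
by rewrite mxtrace_idtens.
Qed.

(** The action of a single Kraus operator of a channel on the reference. It commutes with [idtens F]
    and with adjoining a state of E, as the next lemmas show. *)
Definition refconj r r' n (K : 'M[C]_(r, r')) (X : 'M[C]_(r' * n)) :
  'M[C]_(r * n) := tensmx K 1%:M *m X *m (tensmx K 1%:M) ^t*.

Lemma block_refconj r r' n (K : 'M[C]_(r, r')) (X : 'M[C]_(r' * n)) i j :
  block (refconj K X) i j =
  \sum_i' \sum_j' (K i i' * (K j j')^*%R) *: block X i' j'.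
Proof.
apply/matrixP => k l; rewrite blockE /refconj adjmx_tens adjmx1.
rewrite mxE sum_mxtens summxE.
under [RHS]eq_bigr do rewrite summxE.
rewrite [RHS]exchange_big /=; apply: eq_bigr => j' _.
rewrite (bigD1 l) //= big1 ?addr0; last first.
  by move=> l' nl; rewrite tensmxE !mxE (negbTE nl) !mulr0.
rewrite mxE sum_mxtens mulr_suml.
apply: eq_bigr => i' _; rewrite (bigD1 k) //= big1 ?addr0; last first.
  by move=> k' nk; rewrite tensmxE !mxE eq_sym (negbTE nk) mulr0 mul0r.
by rewrite !tensmxE !mxE !eqxx !mulr1 mulrAC.
Qed.

Lemma idtens_refconj r r' m n (F : {linear 'M[C]_m -> 'M[C]_n})
    (K : 'M[C]_(r, r')) (X : 'M[C]_(r' * m)) :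
  idtens F (refconj K X) = refconj K (idtens F X).
Proof.
apply: blockP => i j; rewrite block_idtens !block_refconj linear_sum.
apply: eq_bigr => i' _; rewrite linear_sum; apply: eq_bigr => j' _.
by rewrite linearZ block_idtens.
Qed.

Lemma tensRAE_refconj r r' a e (K : 'M[C]_(r, r')) (rho : 'M[C]_(r' * a))
    (sigma : 'M[C]_e) :
  tensRAE (refconj K rho) sigma = refconj K (tensRAE rho sigma).
Proof.
apply: blockP => i j; rewrite block_tensRAE !block_refconj.
rewrite (linear_sumE _ _ _ (@tensmx_linearl _ _ _ _ sigma)).
apply: eq_bigr => i' _.
rewrite (linear_sumZ _ _ _ _ (@tensmx_linearl _ _ _ _ sigma)).
by apply: eq_bigr => j' _; rewrite block_tensRAE.
Qed.

End Blocks.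

(** * Quantum channels *)

Section Kraus.
Variable R : realType.
Local Notation C := R[i].

Definition kraus (I : finType) m n (K : I -> 'M[C]_(n, m)) (X : 'M[C]_m) :
  'M[C]_n := \sum_i K i *m X *m (K i) ^t*.

Lemma kraus_linear (I : finType) m n (K : I -> 'M[C]_(n, m)) : linear (kraus K).
Proof.
move=> c X Y; rewrite /kraus scaler_sumr -big_split; apply: eq_bigr => i _ /=.
by rewrite mulmxDr mulmxDl -scalemxAr -scalemxAl.
Qed.

HB.instance Definition _ (I : finType) m n (K : I -> 'M[C]_(n, m)) :=
  GRing.isLinear.Build C 'M[C]_m 'M[C]_n _ (kraus K) (kraus_linear K).

Lemma block_congr_tens1 r m n (K : 'M[C]_(n, m)) (X : 'M[C]_(r * m)) i j :
  block (tensmx 1%:M K *m X *m (tensmx 1%:M K) ^t*) i j =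
  K *m block X i j *m K ^t*.
Proof.
apply/matrixP => k l; rewrite blockE adjmx_tens adjmx1 !mxE sum_mxtens.
rewrite (bigD1 j) //= [X in _ + X]big1 ?addr0; last first.
  by move=> j' nj; apply: big1 => l' _; rewrite tensmxE !mxE (negbTE nj) mul0r mulr0.
apply: eq_bigr => l' _; rewrite tensmxE !mxE eqxx mul1r sum_mxtens.
congr (_ * _); rewrite (bigD1 i) //= [X in _ + X]big1 ?addr0; last first.
  by move=> i' ni; apply: big1 => k' _; rewrite tensmxE !mxE eq_sym (negbTE ni) !mul0r.
by apply: eq_bigr => k' _; rewrite tensmxE !mxE eqxx mul1r.
Qed.

Lemma cp_kraus (I : finType) m n (K : I -> 'M[C]_(n, m)) : cp (kraus K).
Proof.
move=> r X pX.
have -> : idtens (kraus K) X =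
    \sum_i tensmx 1%:M (K i) *m X *m (tensmx 1%:M (K i)) ^t*.
  apply: blockP => i j; rewrite block_idtens (linear_sumE _ _ _ (@block_linear _ _ _ i j)).
  by apply: eq_bigr => k _; rewrite block_congr_tens1.
by apply: psd_sum => i _; exact: psd_congr.
Qed.

Lemma cptp_kraus (I : finType) m n (K : I -> 'M[C]_(n, m)) :
  \sum_i (K i) ^t* *m K i = 1%:M -> cptp (kraus K).
Proof.
move=> K1; split=> [|X]; first exact: cp_kraus.
rewrite /kraus linear_sum /=.
under eq_bigr do rewrite mxtrace_mulC mulmxA.
by rewrite -linear_sum /= -mulmx_suml K1 mul1mx.
Qed.

(** The selected rows of the identity form the operator [<i| (x) id]. This form gives [ptrace] its
    linearity, its positivity and its status as a channel. *)
Lemma ptrace_kraus r n : @ptrace R r n =1 kraus (fun i : 'I_r =>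
  rowsub (fun k : 'I_n => mxtens_index (i, k)) (1%:M : 'M[C]_(r * n))).
Proof.
move=> X; apply: eq_bigr => i _; rewrite -rowsubE.
apply/matrixP => k l; rewrite !mxE (bigD1 (mxtens_index (i, l))) //=.
by rewrite big1 ?addr0 => [|q nq]; rewrite !mxE ?eqxx ?conjC1 ?mulr1 //;
  rewrite eq_sym (negbTE nq) conjC0 mulr0.
Qed.

Lemma mxtrace_ptrace r n (X : 'M[C]_(r * n)) : \tr (ptrace X) = \tr X.
Proof. by rewrite mxtrace_blocks linear_sum. Qed.

Lemma cptp_ptrace r n : cptp (kraus (fun i : 'I_r =>
  rowsub (fun k : 'I_n => mxtens_index (i, k)) (1%:M : 'M[C]_(r * n)))).
Proof.
split; first exact: cp_kraus.
by move=> X; rewrite /= -ptrace_kraus mxtrace_ptrace.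
Qed.

Lemma psd_ptrace r n (X : 'M[C]_(r * n)) : psd X -> psd (ptrace X).
Proof.
move=> pX; rewrite ptrace_kraus; apply: psd_sum => i _; exact: psd_congr.
Qed.

Lemma density_ptrace r n (X : 'M[C]_(r * n)) : density X -> density (ptrace X).
Proof. by move=> [pX tX]; split; [exact: psd_ptrace|rewrite mxtrace_ptrace]. Qed.

Lemma mxtrace_delta_diag k (x : 'I_k) : \tr (delta_mx x x : 'M[C]_k) = 1.
Proof.
rewrite /mxtrace (bigD1 x) //= mxE !eqxx big1 ?addr0 // => y ny.
by rewrite mxE (negbTE ny).
Qed.

Lemma psd_delta_diag k (x : 'I_k) : psd (delta_mx x x : 'M[C]_k).
Proof.
have := psd_gram (delta_mx x 0 : 'cV[C]_k).
by rewrite trmx_delta map_delta_mx mul_delta_mx.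
Qed.

Lemma psd_flag k n (p : 'I_k -> R) (rho : 'I_k -> 'M[C]_n) :
  (forall x, 0 <= p x) -> (forall x, psd (rho x)) ->
  psd (\sum_x (p x)%:C *: tensmx (delta_mx x x) (rho x)).
Proof.
move=> p0 prho; apply: psd_sum => x _; apply: psdZ; first by rewrite ler0c.
by apply: psd_tens => //; exact: psd_delta_diag.
Qed.

Lemma density_flag k n (p : 'I_k -> R) (rho : 'I_k -> 'M[C]_n) :
  (forall x, 0 <= p x) -> \sum_x p x = 1 -> (forall x, density (rho x)) ->
  density (\sum_x (p x)%:C *: tensmx (delta_mx x x) (rho x)).
Proof.
move=> p0 p1 drho; split; first by apply: psd_flag => // x; case: (drho x).
rewrite linear_sum /= -[RHS](rmorph1 (real_complex R)) -p1 rmorph_sum.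
apply: eq_bigr => x _; have [_ trho] := drho x.
by rewrite linearZ /= mxtrace_tens mxtrace_delta_diag mul1r trho mulr1.
Qed.

(** The right side is the divergence of the flagged mixtures, and the partial trace over the flag is
    a channel. *)
Lemma divergence_mixture (D : functional R) k n (p : 'I_k -> R)
    (rho sigma : 'I_k -> 'M[C]_n) :
  quantum_divergence D -> direct_sum_property D ->
  (forall x, 0 <= p x) -> \sum_x p x = 1 ->
  (forall x, density (rho x)) -> (forall x, psd (sigma x)) ->
  (D n (\sum_x (p x)%:C *: rho x)%R (\sum_x (p x)%:C *: sigma x)%R
    <= \sum_x (p x)%:E * D n (rho x) (sigma x))%E.
Proof.
move=> [_ dpi] ds p0 p1 drho psigma; rewrite -ds //.
have tr_flag (A : 'I_k -> 'M[C]_n) :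
    ptrace (\sum_x (p x)%:C *: tensmx (delta_mx x x) (A x)) = \sum_x (p x)%:C *: A x.
  rewrite ptrace_kraus linear_sum /=; apply: eq_bigr => x _.
  by rewrite linearZ /= -ptrace_kraus ptrace_tens mxtrace_delta_diag scale1r.
rewrite -!tr_flag !ptrace_kraus; apply: dpi; first exact: cptp_ptrace.
  exact: density_flag.
exact: psd_flag.
Qed.

End Kraus.

(** * Channels relating two factorizations of a Gram matrix *)

Section Extension.
Variable C : numClosedFieldType.

(* With the rank factorization Psi = B S, the operators Phi_i S^-1 G^-1 B^*, for
   G = B^* B, map Psi to Phi_i and satisfy sum K^* K = P, the orthogonal projection
   onto the range of Psi. The last s operators complete this to a channel. *)
Lemma isometric_extension (I : finType) r s a (Phi : I -> 'M[C]_(r, a))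
    (Psi : 'M[C]_(s, a)) : (0 < r)%N ->
  \sum_i (Phi i) ^t* *m Phi i = Psi ^t* *m Psi ->
  exists K : I + 'I_s -> 'M[C]_(r, s),
    [/\ \sum_k (K k) ^t* *m K k = 1%:M,
        forall i, K (inl i) *m Psi = Phi i
      & forall j, K (inr j) *m Psi = 0].
Proof.
(* The completing operators [delta_mx 0 j *m Q] need a row of index 0, hence a nonzero [r]. *)
case: r Phi => // r Phi _ PhiPsi.
pose B := col_base Psi; pose S := row_base Psi.
have BS : B *m S = Psi by exact: mulmx_base.
have SV : S *m pinvmx S = 1%:M by apply: mulmxVp; exact: row_base_free.
have VB : pinvmx B *m B = 1%:M by apply: mulVpmx; exact: col_base_full.
(* The rows of [Phi i] lie in the row space of [Psi]: the Gram identity makes the nonnegative traces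
   for [Phi i *m cokermx Psi] sum to zero, so each product vanishes. *)
have PhiS i : Phi i *m pinvmx S *m S = Phi i.
  apply: mulmxKpV; rewrite eq_row_base submxE.
  apply/eqP/mxtrace_gram_eq0; apply/eqP.
  have : \sum_i \tr ((Phi i *m cokermx Psi) ^t* *m (Phi i *m cokermx Psi)) = 0.
    under eq_bigr do rewrite adjmxM mulmxA -(mulmxA (_ ^t*)).
    rewrite -linear_sum /= -mulmx_suml -mulmx_sumr PhiPsi.
    by rewrite -!mulmxA mulmx_coker !mulmx0 mxtrace0.
  move/psumr_eq0P => -> // i' _; exact: mxtrace_gram_ge0.
move: (\rank Psi) B S BS SV VB PhiS => q B S BS SV VB PhiS.
move: (pinvmx S) SV PhiS => S' SV PhiS.
pose G := B ^t* *m B.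
have Gu : G \in unitmx.
  rewrite -row_free_unit; apply: inj_row_free => v vG.
  have : B *m v ^t* = 0.
    apply: mxtrace_gram_eq0; rewrite adjmxM trmxCK mulmxA -(mulmxA v).
    by rewrite -/G vG mul0mx mxtrace0.
  move/(congr1 (mulmx (pinvmx B))); rewrite mulmxA VB mul1mx mulmx0 => v0.
  by rewrite -[v]trmxCK v0 trmx0 map_mx0.
pose P := B *m invmx G *m B ^t*.
have GA : G ^t* = G by rewrite adjmxM trmxCK.
have GVA : (invmx G) ^t* = invmx G.
  have GVG : (invmx G) ^t* *m G = 1%:M.
    by rewrite -[X in _ *m X]GA -adjmxM mulmxV // adjmx1.
  by rewrite -[LHS]mulmx1 -(mulmxV Gu) mulmxA GVG mul1mx.
have PA : P ^t* = P by rewrite /P adjmxM trmxCK (adjmxM B) GVA mulmxA.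
have PB : P *m B = B by rewrite -!mulmxA -/G mulVmx // mulmx1.
have PP : P *m P = P by rewrite {2}/P !mulmxA PB.
have PPsi : P *m Psi = Psi by rewrite -BS mulmxA PB.
pose Q := 1%:M - P.
have QA : Q ^t* = Q by rewrite adjmxD adjmxN adjmx1 PA.
have QQ : Q *m Q = Q.
  by rewrite mulmxBl !mulmxBr !mul1mx !mulmx1 PP subrr subr0.
exists (fun k => match k with
  | inl i => Phi i *m S' *m invmx G *m B ^t*
  | inr j => delta_mx 0 j *m Q end); split=> [|i|j].
- rewrite big_sumType /=.
  (* Factoring out the common right factor X leaves the Gram matrix of [Psi] in the middle, and
     [Psi] X is the projection [P]. *)
  have -> : \sum_i (Phi i *m S' *m invmx G *m B ^t*) ^t* *m
      (Phi i *m S' *m invmx G *m B ^t*) = P.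
    transitivity (\sum_i (S' *m invmx G *m B ^t*) ^t* *m
        ((Phi i) ^t* *m Phi i) *m (S' *m invmx G *m B ^t*)).
      by apply: eq_bigr => i _; rewrite !adjmxM !mulmxA.
    rewrite -mulmx_suml -mulmx_sumr PhiPsi mulmxA -adjmxM -mulmxA.
    have -> : Psi *m (S' *m invmx G *m B ^t*) = P.
      by rewrite -BS !mulmxA -(mulmxA B S) SV mulmx1.
    by rewrite PA PP.
  have -> : \sum_j (delta_mx 0 j *m Q) ^t* *m (delta_mx (0 : 'I_r.+1) j *m Q) = Q.
    transitivity (\sum_j Q *m delta_mx j j *m Q).
      apply: eq_bigr => j _; rewrite adjmxM QA trmx_delta map_delta_mx !mulmxA.
      by rewrite -(mulmxA Q (delta_mx j 0)) mul_delta_mx.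
    by rewrite -mulmx_suml -mulmx_sumr -mx1_sum_delta mulmx1 QQ.
  by rewrite /Q addrC subrK.
- by rewrite -BS !mulmxA -(mulmxA _ _ B) -/G mulmxKV // PhiS.
- by rewrite -mulmxA mulmxBl mul1mx PPsi subrr mulmx0.
Qed.

End Extension.

(** * Divergence of the outputs *)

Section Reference.
Variable R : realType.
Local Notation C := R[i].

Lemma tensmx11 m n : tensmx (1%:M : 'M[C]_m) (1%:M : 'M[C]_n) = 1%:M.
Proof.
apply/matrixP => p q; case: (mxtens_indexP p) => i k.
case: (mxtens_indexP q) => j l.
by rewrite tensmxE !mxE (can_eq (@mxtens_indexK _ _)) xpair_eqE -natrM mulnb.
Qed.

(** The correspondence between bipartite vectors and matrices: operators on the reference become
    left multiplications, and the marginal on A a Gram matrix. *)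
Definition vecmat r a (phi : 'cV[C]_(r * a)) : 'M[C]_(r, a) :=
  \matrix_(i, k) phi (mxtens_index (i, k)) 0.

Lemma vecmat_inj r a : injective (@vecmat r a).
Proof.
move=> phi psi /matrixP e; apply/colP => p; case: (mxtens_indexP p) => i k.
by have := e i k; rewrite !mxE.
Qed.

Lemma vecmat_tens1 r r' a (K : 'M[C]_(r, r')) (phi : 'cV[C]_(r' * a)) :
  vecmat (tensmx K 1%:M *m phi) = K *m vecmat phi.
Proof.
apply/matrixP => i k; rewrite !mxE sum_mxtens; apply: eq_bigr => j _.
rewrite (bigD1 k) //= big1 ?addr0 => [|l nl].
  by rewrite tensmxE !mxE eqxx mulr1.
by rewrite tensmxE !mxE eq_sym (negbTE nl) mulr0 mul0r.
Qed.

Lemma refconj_ketbra r r' a (K : 'M[C]_(r, r')) (phi : 'cV[C]_(r' * a)) :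
  refconj K (ketbra phi) = ketbra (tensmx K 1%:M *m phi).
Proof. by rewrite /ketbra adjmxM /refconj !mulmxA. Qed.

(** The transpose appears because the marginal conjugates its column index, the Gram matrix its row
    index. *)
Lemma ptrace_ketbra r a (phi : 'cV[C]_(r * a)) :
  ptrace (ketbra phi) = ((vecmat phi) ^t* *m vecmat phi)^T.
Proof.
apply/matrixP => k l; rewrite /ptrace summxE !mxE; apply: eq_bigr => i _.
by rewrite !mxE big_ord1 !mxE mulrC.
Qed.

Lemma ptrace_sum r a I (s : seq I) (P : pred I) (F : I -> 'M[C]_(r * a)) :
  ptrace (\sum_(i <- s | P i) F i) = \sum_(i <- s | P i) ptrace (F i).
Proof.
by rewrite ptrace_kraus linear_sum; apply: eq_bigr => i _; rewrite ptrace_kraus.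
Qed.

(** A Gram factor of [rho] splits it into unnormalized pure states, its columns. Equality of
    marginals is the Gram identity between their matrices and that of [psi], so
    [isometric_extension] gives operators sending [psi] to each column, while the completing ones
    annihilate it. *)
Lemma reference_channel r s a (rho : 'M[C]_(r * a)) (psi : 'cV[C]_(s * a)) :
  (0 < r)%N -> psd rho -> ptrace rho = ptrace (ketbra psi) ->
  exists (I : finType) (K : I -> 'M[C]_(r, s)),
    \sum_i (K i) ^t* *m K i = 1%:M /\
    rho = \sum_i refconj (K i) (ketbra psi).
Proof.
move=> r0 /psd_gramP[B rhoE] trE.
have rho_cols : rho = \sum_k ketbra (col k B).
  rewrite rhoE; apply/matrixP => p q; rewrite summxE mxE; apply: eq_bigr => k _.
  by rewrite !mxE big_ord1 !mxE.
have [K [K1 KPhi K0]] : exists K : 'I_(r * a) + 'I_s -> 'M[C]_(r, s),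
    [/\ \sum_k (K k) ^t* *m K k = 1%:M,
        forall i, K (inl i) *m vecmat psi = vecmat (col i B)
      & forall j, K (inr j) *m vecmat psi = 0].
  apply: isometric_extension => //; apply: trmx_inj.
  rewrite linear_sum /= -ptrace_ketbra -trE rho_cols ptrace_sum.
  by apply: eq_bigr => k _; rewrite ptrace_ketbra.
exists _, K; split=> //; rewrite big_sumType /= [X in _ + X]big1 ?addr0.
  rewrite rho_cols; apply: eq_bigr => i _; rewrite refconj_ketbra.
  by congr ketbra; apply: vecmat_inj; rewrite vecmat_tens1 KPhi.
move=> j _; rewrite refconj_ketbra (_ : _ *m psi = 0) ?/ketbra ?mul0mx //.
apply: vecmat_inj; rewrite vecmat_tens1 K0.
by apply/matrixP => i k; rewrite !mxE.
Qed.

Lemma density_ketbra r a (rho : 'M[C]_a) (psi : 'cV[C]_(r * a)) :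
  density rho -> purification rho psi -> density (ketbra psi).
Proof.
move=> [_ trho] psiE; split; first exact: psd_gram.
by rewrite -mxtrace_ptrace psiE.
Qed.

Lemma density_gt0 r a (rho : 'M[C]_(r * a)) : density rho -> (0 < r)%N.
Proof.
case: r rho => // rho [_]; rewrite mxtrace_blocks big_ord0 => /eqP.
by rewrite eq_sym oner_eq0.
Qed.

End Reference.

Section OutputDivergence.
Variables (R : realType) (D : functional R) (a e b : nat).
Variables (N M : {linear 'M[R[i]]_(a * e) -> 'M[R[i]]_b}).
Hypotheses (dD : quantum_divergence D) (sD : direct_sum_property D).
Hypotheses (cN : cptp N) (cM : cp M).
Local Notation C := R[i].

Lemma density_idtensN r (rho : 'M[C]_(r * a)) (sigma : 'M[C]_e) :
  density rho -> density sigma -> density (idtens N (tensRAE rho sigma)).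
Proof.
by move=> drho dsigma; apply: density_idtens => //; exact: density_tensRAE.
Qed.

Lemma psd_idtensM r (rho : 'M[C]_(r * a)) (omega : 'M[C]_e) :
  density rho -> density omega -> psd (idtens M (tensRAE rho omega)).
Proof. by move=> [prho _] [pomega _]; apply: cM; exact: psd_tensRAE. Qed.

Lemma output_div_neq_ninfty r (rho : 'M[C]_(r * a)) (sigma omega : 'M[C]_e) :
  density rho -> density sigma -> density omega ->
  (output_div D N M rho sigma omega != -oo)%E.
Proof.
move=> drho dsigma domega; apply: dD.1; first exact: density_idtensN.
exact: psd_idtensM.
Qed.

(** The channel on the reference that turns [ketbra psi] into [rho] commutes with [N] and [M], so
    one and the same channel maps both outputs for [psi] to those for [rho], and data processing
    applies. *)
Lemma output_div_le_purification r s (rho : 'M[C]_(r * a))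
    (psi : 'cV[C]_(s * a)) (sigma omega : 'M[C]_e) :
  density rho -> purification (ptrace rho) psi ->
  density sigma -> density omega ->
  (output_div D N M rho sigma omega <= output_div D N M (ketbra psi) sigma omega)%E.
Proof.
move=> drho psiE dsigma domega.
have [I [K [K1 rhoE]]] := reference_channel (density_gt0 drho) drho.1 (esym psiE).
have dpsi := density_ketbra (density_ptrace drho) psiE.
have lift (F : {linear 'M[C]_(a * e) -> 'M[C]_b}) (X : 'M[C]_e) :
    idtens F (tensRAE rho X) =
    kraus (fun i => tensmx (K i) (1%:M : 'M[C]_b)) (idtens F (tensRAE (ketbra psi) X)).
  rewrite rhoE (linear_sumE _ _ _ (@tensRAE_linearl _ _ _ _ X)) linear_sum.
  by apply: eq_bigr => i _ /=; rewrite tensRAE_refconj idtens_refconj.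
rewrite /output_div !lift; apply: dD.2.
- apply: cptp_kraus.
  under eq_bigr do rewrite adjmx_tens adjmx1 tensmx_mul mulmx1.
  rewrite -(linear_sumE _ _ _ (@tensmx_linearl _ _ _ _ _ (1%:M : 'M[C]_b))) K1.
  exact: tensmx11.
- exact: density_idtensN.
- exact: psd_idtensM.
Qed.

(** Absorbs a flag of dimension [k] into the reference: the pair of flag index and reference index
    becomes one reference index. *)
Lemma block_castA k r n (X : 'M[C]_(k * (r * n))) x y i j :
  block (castmx (mulnA k r n, mulnA k r n) X)
    (mxtens_index (x, i)) (mxtens_index (y, j)) = block (block X x y) i j.
Proof.
apply/matrixP => p q; rewrite !blockE castmxE.
by congr (X _ _); apply: val_inj; rewrite /= mulnDl mulnA addnA.
Qed.

Lemma divergence_castmx n m (eq_nm : n = m) (X Y : 'M[C]_n) :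
  @D m (castmx (eq_nm, eq_nm) X) (castmx (eq_nm, eq_nm) Y) = @D n X Y.
Proof. by case: m / eq_nm; rewrite !castmx_id. Qed.

(** [N] and [M] leave the reference alone, hence also the flag inside it, so both outputs are
    flagged mixtures and the direct-sum property evaluates them. *)
Lemma output_div_flag k r (p : 'I_k -> R) (rho : 'I_k -> 'M[C]_(r * a))
    (sigma omega : 'M[C]_e) :
  (forall x, 0 <= p x) -> \sum_x p x = 1 -> (forall x, density (rho x)) ->
  density sigma -> density omega ->
  output_div D N M (castmx (mulnA k r a, mulnA k r a)
    (\sum_x (p x)%:C *: tensmx (delta_mx x x) (rho x))) sigma omega =
  (\sum_x (p x)%:E * output_div D N M (rho x) sigma omega)%E.
Proof.
move=> p0 p1 drho dsigma domega.
have block_flag n (A : 'I_k -> 'M[C]_n) x y :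
    block (\sum_z (p z)%:C *: tensmx (delta_mx z z) (A z)) x y =
    \sum_z ((p z)%:C * (delta_mx z z : 'M[C]_k) x y) *: A z.
  rewrite (linear_sumZ _ _ _ _ (@block_linear _ _ _ x y)).
  by apply: eq_bigr => z _; rewrite block_tens scalerA.
have flagE (F : {linear 'M[C]_(a * e) -> 'M[C]_b}) (X : 'M[C]_e) :
    idtens F (tensRAE (castmx (mulnA k r a, mulnA k r a)
      (\sum_x (p x)%:C *: tensmx (delta_mx x x) (rho x))) X) =
    castmx (mulnA k r b, mulnA k r b)
      (\sum_x (p x)%:C *: tensmx (delta_mx x x) (idtens F (tensRAE (rho x) X))).
  apply: blockP => xi yj; case: (mxtens_indexP xi) => x i.
  case: (mxtens_indexP yj) => y j; rewrite block_idtens block_tensRAE.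
  rewrite !block_castA !block_flag.
  rewrite !(linear_sumZ _ _ _ _ (@block_linear _ _ _ i j)).
  rewrite (linear_sumZ _ _ _ _ (@tensmx_linearl _ _ _ _ _ X)) linear_sum.
  by apply: eq_bigr => z _; rewrite linearZ /= block_idtens block_tensRAE.
rewrite /output_div !flagE divergence_castmx sD // => x.
  exact: density_idtensN.
exact: psd_idtensM.
Qed.

(** The witness is the marginal of the flagged mixture of [rho0] and [rho1], whose value is the
    average and which its purifications dominate. It does not depend on [sigma] and [omega], as
    [concavelike] demands. *)
Lemma output_div_concave r s (rho0 rho1 : 'M[C]_(r * a)) (t : R) :
  density rho0 -> density rho1 -> 0 < t < 1 ->
  exists2 rho : 'M[C]_a, density rho & forall (psi : 'cV[C]_(s * a)),
    purification rho psi -> forall sigma omega, density sigma -> density omega ->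
    (t%:E * output_div D N M rho0 sigma omega
     + (1 - t)%:E * output_div D N M rho1 sigma omega
     <= output_div D N M (ketbra psi) sigma omega)%E.
Proof.
move=> drho0 drho1 /andP[t0 t1].
pose p (x : 'I_2) : R := if x == 0 then t else 1 - t.
pose rho x := if x == 0 :> 'I_2 then rho0 else rho1.
have p0 x : 0 <= p x by rewrite /p; case: ifP => _; rewrite ?subr_ge0 ltW.
have p1 : \sum_x p x = 1 by rewrite big_ord_recl big_ord1 /p /= addrC subrK.
have drho x : density (rho x) by rewrite /rho; case: ifP.
pose flag : 'M[C]_(2 * r * a) := castmx (mulnA 2 r a, mulnA 2 r a)
  (\sum_x (p x)%:C *: tensmx (delta_mx x x) (rho x)).
have dflag : density flag.
  have [pf tf] := density_flag p0 p1 drho; split; first exact: psd_castmx.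
  rewrite /flag; case: _ / (mulnA 2 r a); rewrite castmx_id; exact: tf.
exists (ptrace flag) => [|psi psiE sigma omega dsigma domega].
  exact: density_ptrace.
apply: le_trans (output_div_le_purification dflag psiE dsigma domega).
by rewrite output_div_flag // big_ord_recl big_ord1.
Qed.

(** Both outputs are linear in the state of E, so [divergence_mixture] with two terms applies. *)
Lemma output_div_convex r (rho : 'M[C]_(r * a))
    (sigma0 sigma1 omega0 omega1 : 'M[C]_e) (t : R) :
  density rho -> density sigma0 -> density sigma1 ->
  density omega0 -> density omega1 -> 0 < t < 1 ->
  (output_div D N M rho (t%:C *: sigma0 + (1 - t)%:C *: sigma1)%R
     (t%:C *: omega0 + (1 - t)%:C *: omega1)%R
   <= t%:E * output_div D N M rho sigma0 omega0
      + (1 - t)%:E * output_div D N M rho sigma1 omega1)%E.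
Proof.
move=> drho ds0 ds1 do0 do1 /andP[t0 t1].
pose p (x : 'I_2) : R := if x == 0 then t else 1 - t.
pose sel (A B : 'M[C]_e) x := if x == 0 :> 'I_2 then A else B.
have p0 x : 0 <= p x by rewrite /p; case: ifP => _; rewrite ?subr_ge0 ltW.
have p1 : \sum_x p x = 1 by rewrite big_ord_recl big_ord1 /p /= addrC subrK.
have mixE (F : {linear 'M[C]_(a * e) -> 'M[C]_b}) A B :
    idtens F (tensRAE rho (t%:C *: A + (1 - t)%:C *: B)) =
    \sum_x (p x)%:C *: idtens F (tensRAE rho (sel A B x)).
  transitivity (idtens F (tensRAE rho (\sum_x (p x)%:C *: sel A B x))).
    by rewrite big_ord_recl big_ord1.
  rewrite (linear_sumZ _ _ _ _ (@tensRAE_linearr _ _ _ _ rho)) linear_sum.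
  by apply: eq_bigr => x _; rewrite linearZ.
rewrite /output_div !mixE; apply: le_trans (divergence_mixture _ _ p0 p1 _ _) _ => //.
- by move=> x; apply: density_idtensN => //; rewrite /sel; case: ifP.
- by move=> x; apply: psd_idtensM => //; rewrite /sel; case: ifP.
by rewrite big_ord_recl big_ord1.
Qed.

End OutputDivergence.

(** * Compactness of the set of density operators *)

Section MatrixTopology.
Variable K : numFieldType.

Lemma continuous_mx_entries (T : topologicalType) m n (f : T -> 'M[K]_(m, n)) :
  (forall i j, continuous (fun x => f x i j)) -> continuous f.
Proof.
move=> fc x U [P fP PU]; rewrite /nbhs /=.
have : \forall y \near x, forall i j, P i j (f y i j).
  apply: filter_forall => i; apply: filter_forall => j.
  exact: fc (fP i j).
by apply: filterS => y Py; exact: PU.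
Qed.

(** Each entry of [f A] is a finite linear combination of the entries of [A]. *)
Lemma continuous_linear_mx m n p q (f : 'M[K]_(m, n) -> 'M[K]_(p, q)) :
  linear f -> continuous f.
Proof.
move=> lf; pose g : {linear 'M[K]_(m, n) -> 'M[K]_(p, q)} :=
  HB.pack f (GRing.isLinear.Build K 'M[K]_(m, n) 'M[K]_(p, q) *:%R f lf).
apply: continuous_mx_entries => k l.
have -> : (fun A => f A k l) =
    (fun A : 'M[K]_(m, n) => \sum_i \sum_j A i j * (g (delta_mx i j)) k l).
  apply/funext => A; rewrite -[f A]/(g A) {1}(matrix_sum_delta A).
  rewrite linear_sum summxE; apply: eq_bigr => i _.
  rewrite linear_sum summxE; apply: eq_bigr => j _.
  by rewrite linearZ mxE.
apply: continuous_big => [|i _]; first exact: add_continuous.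
apply: continuous_big => [|j _]; first exact: add_continuous.
move=> A; apply: cvgMr_tmp; first exact: (@nbhs_filter _ A).
exact: coord_continuous.
Qed.

(** The order may be partial, as on the complex numbers, so closedness comes from the equation z =
    |z| between continuous functions. *)
Lemma closed_ge0 : closed [set z : K | 0 <= z].
Proof.
have -> : [set z : K | 0 <= z] = (fun z => `|z| - z) @^-1` [set 0].
  apply/funext => z; apply/propext; rewrite /= ger0_def; split => [/eqP ->|/eqP].
    by rewrite subrr.
  by rewrite subr_eq0.
apply: preimage_closed => [z _|]; last first.
  exact/accessible_closed_set1/hausdorff_accessible/norm_hausdorff.
apply: (@cvgB K K^o _ (nbhs z)); [exact: norm_continuous|exact: cvg_id].
Qed.

Lemma closed_norm_le (k : K) : closed [set z : K | `|z| <= k].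
Proof.
have -> : [set z : K | `|z| <= k] = (fun z => k - `|z|) @^-1` [set z : K | 0 <= z].
  by apply/funext => z; rewrite /= subr_ge0.
apply: preimage_closed => [z _|]; last exact: closed_ge0.
apply: (@cvgB K K^o _ (nbhs z)); [exact: cvg_cst|exact: norm_continuous].
Qed.

End MatrixTopology.

Section DensityCompact.
Variable R : realType.
Local Notation C := R[i].

Lemma normc_real (x : R) : `|x%:C| = `|x|%:C :> C.
Proof. by rewrite normc_def /= expr0n addr0 sqrtr_sqr. Qed.

Lemma normc_ge_Im (z : C) : `|complex.Im z|%:C <= `|z|.
Proof. by rewrite normc_def lecR -sqrtr_sqr ler_wsqrtr // lerDr sqr_ge0. Qed.

(** The radius of a ball is itself a complex number; positivity makes it real, and each coordinate
    receives half of it. *)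
Lemma continuous_Complex : continuous (fun p : R * R => p.1 +i* p.2 : C).
Proof.
move=> [x y] /= U /nbhs_ballP[e /= e0 eU].
have eE : e = (complex.Re e)%:C.
  by case: e e0 {eU} => a b; rewrite ltcE /= => /andP[/eqP -> _].
have e'0 : 0 < complex.Re e by move: e0; rewrite {1}eE ltcR.
have e20 : 0 < complex.Re e / 2 by rewrite divr_gt0.
exists (ball x (complex.Re e / 2), ball y (complex.Re e / 2)) => /=.
  by split; apply: nbhsx_ballx.
move=> [x' y'] /= [xx' yy']; apply: eU; rewrite /ball /= /ball_ /=.
have -> : x +i* y - (x' +i* y') = (x - x')%:C + 'i * (y - y')%:C :> C.
  by apply/eqP; rewrite eq_complex /=; apply/andP; split; apply/eqP; ring.
have ni : `|'i : C| = 1 by rewrite normc_def /= expr0n expr1n add0r sqrtr1.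
rewrite (le_lt_trans (ler_normD _ _)) // normrM ni mul1r !normc_real eE -rmorphD /=.
by rewrite ltcR (splitr (complex.Re e)) ltrD.
Qed.

(** A closed part of the continuous image of a compact real square. *)
Lemma compact_complex_ball (k : R) : compact [set z : C | `|z| <= k%:C].
Proof.
have -> : [set z : C | `|z| <= k%:C] =
    ((fun p : R * R => p.1 +i* p.2 : C) @` (`[- k, k] `*` `[- k, k])) `&`
    [set z : C | `|z| <= k%:C].
  apply/seteqP; split => z /=; last by case.
  move=> zk; split => //.
  exists (complex.Re z, complex.Im z); last by case: z {zk}.
  split; rewrite /= in_itv /= -ler_norml -lecR.
    exact: le_trans (normc_ge_Re z) zk.
  exact: le_trans (normc_ge_Im z) zk.
apply: compact_closedI; last exact: closed_norm_le.
apply: continuous_compact; first exact/continuous_subspaceT/continuous_Complex.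
by apply: compact_setX; exact: segment_compact.
Qed.

Lemma closed_psd n : closed (psd : set 'M[C]_n).
Proof.
have -> : psd = \bigcap_(v in [set: 'cV[C]_n])
    (fun A : 'M[C]_n => v ^t* *m A *m v) @^-1`
    ((fun X : 'M[C]_1 => X 0 0) @^-1` [set z : C | 0 <= z]).
  apply/seteqP; split => A; first by move=> pA v _; exact: pA.
  by move=> pA v; exact: pA.
apply: closed_bigI => v _; apply: preimage_closed => [A _|].
  apply: continuous_linear_mx => c X Y.
  by rewrite mulmxDr mulmxDl -scalemxAr -scalemxAl.
apply: preimage_closed => [A _|]; last exact: closed_ge0.
exact: coord_continuous.
Qed.

Lemma closed_density n : closed (density : set 'M[C]_n).
Proof.
(* The trace is written as a 1 x 1 matrix so that [continuous_linear_mx] covers it. *)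
have -> : density = psd `&` ((fun A : 'M[C]_n => (\tr A)%:M : 'M[C]_1) @^-1`
    ((fun X : 'M[C]_1 => X 0 0) @^-1` [set 1])).
  by apply/funext => A; rewrite /density /setI /= mxE eqxx mulr1n.
apply: closedI; first exact: closed_psd.
apply: preimage_closed => [A _|].
  apply: continuous_linear_mx => c X Y.
  by rewrite mxtraceD mxtraceZ raddfD /= -scale_scalar_mx.
apply: preimage_closed => [A _|]; first exact: coord_continuous.
exact/accessible_closed_set1/hausdorff_accessible/(@norm_hausdorff C C^o).
Qed.

(** For a Gram factor [B], the squared moduli of its entries sum to the trace 1, so each entry of
    [B] has modulus at most 1 and each entry of [A] is a sum of n products of such entries. This
    crude bound suffices for compactness. *)
Lemma density_entry n (A : 'M[C]_n) i j : density A -> `|A i j| <= n%:R.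
Proof.
move=> [/psd_gramP[B ->]]; rewrite /mxtrace => trB.
have B1 k l : `|B k l| <= 1.
  rewrite -(@ler_pXn2r _ 2) ?nnegrE // expr1n -trB (bigD1 k) //= mxE.
  rewrite (bigD1 l) //= !mxE -normCK -addrA lerDl addr_ge0 //.
    by apply: sumr_ge0 => l' _; rewrite !mxE mul_conjC_ge0.
  apply: sumr_ge0 => k' _; rewrite mxE; apply: sumr_ge0 => l' _.
  by rewrite !mxE mul_conjC_ge0.
rewrite mxE (le_trans (ler_norm_sum _ _ _)) //.
rewrite -[X in _ <= X%:R](card_ord n) -sum1_card natr_sum.
apply: ler_sum => k _; rewrite !mxE normrM norm_conjC.
by rewrite -[1%:R]mulr1 ler_pM.
Qed.

(** A closed subset of a box of matrices; the box is compact as the image under [vec_mx] of a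
    product of discs in a space of row vectors. *)
Lemma compact_density n : compact (density : set 'M[C]_n).
Proof.
have cbox : compact [set v : 'rV[C]_(n * n) | forall i, `|v 0 i| <= n%:R].
  apply: (@rV_compact C _ (fun=> [set z : C | `|z| <= n%:R])) => _.
  have := @compact_complex_ball n%:R.
  by rewrite rmorph_nat.
have cM : compact [set vec_mx v | v in
    [set v : 'rV[C]_(n * n) | forall i, `|v 0 i| <= n%:R]].
  apply: continuous_compact cbox; apply: continuous_subspaceT.
  by apply: continuous_linear_mx; exact: linearP.
apply: (subclosed_compact (@closed_density n) cM) => A dA.
exists (mxvec A); last exact: mxvecK.
by move=> p /=; case/mxvec_indexP: p => i j; rewrite mxvecE; exact: density_entry.
Qed.

End DensityCompact.

(** * Minimax for the output divergence *)

Section Main.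
Variables (R : realType) (D : functional R) (a e b : nat).
Variables (N M : {linear 'M[R[i]]_(a * e) -> 'M[R[i]]_b}).
Hypotheses (dD : quantum_divergence D) (lD : divergence_lsc D).
Hypotheses (sD : direct_sum_property D) (cN : cptp N) (cM : cp M).
Local Notation C := R[i].

Lemma continuous_output r (F : {linear 'M[C]_(a * e) -> 'M[C]_b})
    (rho : 'M[C]_(r * a)) : continuous (fun sigma => idtens F (tensRAE rho sigma)).
Proof.
apply: continuous_linear_mx => c X Y.
by rewrite tensRAE_linearr linearP.
Qed.

Lemma output_div_lsc r (rho : 'M[C]_(r * a)) : density rho ->
  lsc_on (density `*` density)
    (fun so : 'M[C]_e * 'M[C]_e => output_div D N M rho so.1 so.2).
Proof.
move=> drho [sigma omega] c [/= dsigma domega].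
pose out (so : 'M[C]_e * 'M[C]_e) :=
  (idtens N (tensRAE rho so.1), idtens M (tensRAE rho so.2)).
have out_dom so : (density `*` density) so -> (density `*` psd) (out so).
  by move=> [? ?]; split; [exact: density_idtensN|exact: psd_idtensM].
rewrite -[output_div _ _ _ _ _ _]/((fun rs => @D (r * b)%N rs.1 rs.2) (out (sigma, omega))).
move=> /(@lD (r * b)%N (out (sigma, omega)))[V].
move=> nV0 Vc.
(* At a point of the domain, the neighbourhoods of the subspace topology are those within the
   domain, so [V] pulls back along the continuous map [out], which sends pairs of states into the
   domain. *)
have nV : within (density `*` psd) (nbhs (out (sigma, omega))) V.
  by rewrite nbhs_subspace_in; last exact: out_dom.
have cout : out so @[so --> (sigma, omega)] --> out (sigma, omega).
  apply: (@cvg_pair _ _ _ _ (nbhs (out (sigma, omega)).1)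
    (nbhs (out (sigma, omega)).2) _ _ _ (fun so => (out so).1) (fun so => (out so).2)).
    apply: (@cvg_comp _ _ _ fst (fun X => idtens N (tensRAE rho X)) _ (nbhs sigma)).
      exact: cvg_fst.
    exact: continuous_output.
  apply: (@cvg_comp _ _ _ snd (fun X => idtens M (tensRAE rho X)) _ (nbhs omega)).
    exact: cvg_snd.
  exact: continuous_output.
have : \forall so \near (sigma, omega), (density `*` psd) (out so) -> V (out so).
  exact: cout _ nV.
apply: filterS => so /= Vso dso.
by apply: (Vc (out so)); apply: Vso; exact: out_dom.
Qed.

Lemma density_nonempty n : (0 < n)%N -> (density : set 'M[C]_n) !=set0.
Proof.
case: n => // n _; exists (delta_mx 0 0); split.
  exact: psd_delta_diag.
exact: mxtrace_delta_diag.
Qed.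

Lemma convex_density n (A B : 'M[C]_n) (t : R) : density A -> density B ->
  0 < t < 1 -> density (t%:C *: A + (1 - t)%:C *: B).
Proof.
move=> [pA tA] [pB tB] /andP[t0 t1]; split.
  by apply: psdD; apply: psdZ; rewrite ?ler0c ?subr_ge0 // ltW.
by rewrite mxtraceD !mxtraceZ tA tB !mulr1 -rmorphD /= addrC subrK.
Qed.

(** The pair (sigma, omega) is the compact variable of [minimax]; [rho] is only an index, and the
    concavity in it comes from [output_div_concave] applied to two chosen purifications. *)
Lemma output_minimax s (purif : 'M[C]_a -> 'cV[C]_(s * a)) : (0 < e)%N ->
  (forall rho, density rho -> purification rho (purif rho)) ->
  ereal_sup [set ereal_inf
    [set output_div D N M (ketbra (purif rho)) so.1 so.2
    | so in density `*` density] | rho in density] =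
  ereal_inf [set ereal_sup
    [set output_div D N M (ketbra (purif rho)) so.1 so.2
    | rho in density] | so in (density : set 'M[C]_e) `*` (density : set 'M[C]_e)].
Proof.
move=> e0 purifE.
have dpurif rho : density rho -> density (ketbra (purif rho)).
  by move=> drho; apply: density_ketbra drho (purifE _ drho).
pose f (so : 'M[C]_e * 'M[C]_e) rho := output_div D N M (ketbra (purif rho)) so.1 so.2.
apply: (@minimax R _ _ f).
- by have [A dA] := density_nonempty e0; exists (A, A).
- by apply: compact_setX; exact: compact_density.
- by move=> rho drho; apply: output_div_lsc; exact: dpurif.
- move=> so rho [dsigma domega] drho.
  by apply: output_div_neq_ninfty => //; exact: dpurif.
- move=> [s0 o0] [s1 o1] t [/= ds0 do0] [/= ds1 do1] t01.
  exists (t%:C *: s0 + (1 - t)%:C *: s1, t%:C *: o0 + (1 - t)%:C *: o1).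
    by split; exact: convex_density.
  by move=> rho drho; apply: output_div_convex => //; exact: dpurif.
- move=> rho0 rho1 t drho0 drho1 t01.
  have [rho drho rhoP] := @output_div_concave _ D _ _ _ N M dD sD cN cM
    _ s _ _ _ (dpurif _ drho0) (dpurif _ drho1) t01.
  exists rho => // -[sigma omega] [/= dsigma domega].
  by apply: rhoP => //; exact: purifE.
Qed.

End Main.

(** * Comparison of the four expressions *)

Lemma ereal_inf_le (R : realType) (T : Type) (K : set T) (f g : T -> \bar R) :
  (forall x, K x -> (f x <= g x)%E) ->
  (ereal_inf [set f x | x in K] <= ereal_inf [set g x | x in K])%E.
Proof.
move=> fg; apply: le_ereal_inf_tmp => _ [x Kx <-].
by apply: le_trans (fg _ Kx); apply: ereal_inf_lbound; exists x.
Qed.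

Lemma image2_setX (S T U : Type) (A : set S) (B : set T) (f : S -> T -> U) :
  [set f x y | x in A & y in B] = [set f xy.1 xy.2 | xy in A `*` B].
Proof.
apply/seteqP; split => z.
  by move=> [x Ax [y By <-]]; exists (x, y).
by move=> [[x y] [/= Ax By] <-]; exists x => //; exists y.
Qed.

Theorem lemma10 (R : realType) (D : functional R)
    (dA dE dB : nat)
    (N M : {linear 'M[R[i]]_(dA * dE) -> 'M[R[i]]_dB})
    (purif : 'M[R[i]]_dA -> 'cV[R[i]]_(dA * dA)) :
  (0 < dA)%N -> (0 < dE)%N -> (0 < dB)%N ->
  quantum_divergence D ->
  divergence_lsc D ->
  direct_sum_property D ->
  cptp N -> cp M ->
  (forall rho : 'M[R[i]]_dA, density rho -> purification rho (purif rho)) ->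
  [/\ Dmx D N M
      = ereal_sup [set ereal_inf
          [set output_div D N M (ketbra (purif rho)) sigma omega
          | sigma in density & omega in density]
        | rho in density],
      ereal_sup [set ereal_inf
          [set output_div D N M (ketbra (purif rho)) sigma omega
          | sigma in density & omega in density]
        | rho in density]
      = ereal_inf [set ereal_sup
          [set output_div D N M (ketbra (purif rho)) sigma omega
          | rho in density]
        | sigma in density & omega in density]
    & ereal_inf [set ereal_sup
          [set output_div D N M (ketbra (purif rho)) sigma omega
          | rho in density]
        | sigma in density & omega in density]
      = ereal_inf [set ereal_sup (\bigcup_(r : nat)
          [set output_div D N M rho sigma omega
          | rho in (density : set 'M[R[i]]_(r * dA))])
        | sigma in density & omega in density]].
Proof.
move=> _ e0 _ dD lD sD cN cM purifE.
have dpurif rho : density rho -> density (ketbra (purif rho)).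
  by move=> drho; apply: density_ketbra drho (purifE _ drho).
have le_purif r (rho : 'M[R[i]]_(r * dA)) sigma omega :
    density rho -> density sigma -> density omega ->
    (output_div D N M rho sigma omega <=
     output_div D N M (ketbra (purif (ptrace rho))) sigma omega)%E.
  move=> drho; apply: output_div_le_purification => //.
  by apply: purifE; exact: density_ptrace.
split.
- rewrite /Dmx; apply/eqP; rewrite eq_le; apply/andP; split.
    (* A state with any reference is dominated by the purification of its marginal for every pair
       (sigma, omega), hence also after the infimum. *)
    apply: ge_ereal_sup => _ [r _ [rho drho <-]].
    apply: le_ereal_sup_tmp; eexists.
      by exists (ptrace rho); [exact: density_ptrace|reflexivity].
    rewrite !image2_setX; apply: ereal_inf_le => -[sigma omega] [/= ds dom].
    exact: le_purif.
  (* Conversely, the chosen purifications are among the states with r = [dA]. *)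
  apply: ge_ereal_sup => _ [rho drho <-]; apply: ereal_sup_ubound.
  by exists dA => //; exists (ketbra (purif rho)) => //; exact: dpurif.
- under eq_imagel => rho _ do rewrite image2_setX.
  rewrite image2_setX.
  exact: output_minimax.
(* The same two comparisons, now for fixed (sigma, omega), equate the inner suprema. *)
- rewrite !image2_setX; congr ereal_inf; apply: eq_imagel => -[sigma omega] /= [ds dom].
  apply/eqP; rewrite eq_le; apply/andP; split.
    apply: ge_ereal_sup => _ [rho drho <-]; apply: ereal_sup_ubound.
    by exists dA => //; exists (ketbra (purif rho)) => //; exact: dpurif.
  apply: ge_ereal_sup => _ [r _ [rho drho <-]].
  apply: le_ereal_sup_tmp; eexists.
    by exists (ptrace rho); [exact: density_ptrace|reflexivity].
  exact: le_purif.
Qed.
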